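(* Let $G$ be a group. Then $G$ is finite-by-abelian (that is, its commutator subgroup $G'$ is finite) if and only if $G$ is locally (soluble-by-finite) and has the property $\bar{\mathcal{K}}$.
   Context: For subgroups $X,H$ of a group $G$, $[X,H]$ denotes the subgroup generated by all commutators $[x,h]$ with $x\in X$, $h\in H$. A group $G$ has the property $\bar{\mathcal{K}}$ if for each subgroup $X$ of $G$ the set of subgroups $\{[X,H] \mid H\leq G\}$ is finite. A group is soluble-by-finite if it has a soluble normal subgroup of finite index; it is locally (soluble-by-finite) if each of its finitely generated subgroups is soluble-by-finite. *)

(* Defs.v *)
From mathcomp Require Import all_boot.
From mathcomp Require Import boolp classical_sets functions cardinality.

Set Implicit Arguments.
Unset Strict Implicit.
Unset Printing Implicit Defensive.

Local Open Scope classical_set_scope.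
Local Open Scope group_scope.

(* Subgroups are arbitrary [Prop]-valued sets.  This is the counterpart of the
   library's [group_closed], which is restricted to boolean predicates. *)
Definition subgroup {G : groupType} (H : set G) : Prop :=
  H 1 /\ (forall x y : G, H x -> H y -> H (x / y)).

Definition generated {G : groupType} (A : set G) : set G := smallest subgroup A.

(* The library's [[~ x, h]] is x^-1 h^-1 x h.  Since X and H are closed under
   inverses when they are subgroups, the convention x h x^-1 h^-1 would give
   the same subgroup. *)
Definition commutator_subgroup {G : groupType} (X H : set G) : set G :=
  generated [set [~ x, h] | x in X & h in H].

Definition property_Kbar (G : groupType) : Prop :=
  forall X : set G, subgroup X ->
    finite_set [set commutator_subgroup X H | H in @subgroup G].

Definition derived_series {G : groupType} (H : set G) (n : nat) : set G :=
  iter n (fun D => commutator_subgroup D D) H.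

Definition soluble {G : groupType} (H : set G) : Prop :=
  exists n : nat, derived_series H n = [set 1].

Definition normal_in {G : groupType} (N H : set G) : Prop :=
  [/\ subgroup N, N `<=` H & forall x y : G, N x -> H y -> N (x ^ y)].

Definition finite_index_in {G : groupType} (N H : set G) : Prop :=
  finite_set [set [set x * y | y in N] | x in H].

Definition soluble_by_finite {G : groupType} (H : set G) : Prop :=
  exists N : set G, [/\ normal_in N H, soluble N & finite_index_in N H].

Definition finitely_generated {G : groupType} (H : set G) : Prop :=
  exists A : set G, finite_set A /\ H = generated A.

Definition locally_soluble_by_finite (G : groupType) : Prop :=
  forall H : set G, subgroup H -> finitely_generated H -> soluble_by_finite H.

Definition finite_by_abelian (G : groupType) : Prop :=
  finite_set (commutator_subgroup [set: G] [set: G]).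

(* Main.v *)
Require Import Defs.
From HB Require Import structures.
From mathcomp Require Import all_boot all_algebra.
From mathcomp Require Import boolp classical_sets functions cardinality.

(* The idea for the implication from right to left.  Applying Kbar to
   X = <a> or <x> and to H generated by a multiple of a or a power of x, the
   commutators of x with an abelian normal subgroup A generate Z[t, 1/t]-modules
   with few cyclic submodules, where t is conjugation by x, and this forces the
   set of all [a, x] to be finite.  Descending along the derived series of a
   soluble normal subgroup of finite index, one deduces that a finitely generated
   soluble-by-finite group with Kbar is central-by-finite, hence has finite
   derived subgroup by Schur's theorem.  For arbitrary G, the finitely many
   values of [X, <g>] for a finitely generated X are all attained inside one
   finitely generated subgroup, so [X, G] is finite and centralizers of elements
   have finite index.  If G' were infinite, one could then choose successively
   pairs (x_n, y_n) in the centralizer of the previous ones for which the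
   subgroups [<x_n>, <y_n>] are distinct, and X = <x_1, x_2, ...>,
   H_n = <y_n> would contradict Kbar. *)

Set Implicit Arguments.
Unset Strict Implicit.
Unset Printing Implicit Defensive.

Local Open Scope classical_set_scope.
Local Open Scope group_scope.

(** * Finite sets and subgroups *)

Lemma finite_imageP (T U : Type) (f : T -> U) (A : set T) :
  finite_set (f @` A) ->
  exists B : set T, [/\ finite_set B, B `<=` A &
    forall x, A x -> exists2 y, B y & f y = f x].
Proof.
move=> fA; have [A0|/set0P[x0 Ax0]] := eqVneq A set0.
  by exists set0; split => //; rewrite A0.
have /choice[g gP] : forall u, exists x : T,
    (f @` A) u -> A x /\ f x = u.
  move=> u; have [[y Ay yu]|nu] := pselect ((f @` A) u); first by exists y.
  by exists x0.
exists (g @` (f @` A)); split.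
- exact: finite_image.
- by move=> _ [u fAu <-]; have [] := gP u fAu.
- move=> x Ax; have fAx : (f @` A) (f x) by exists x.
  by exists (g (f x)); [exists (f x) | have [] := gP _ fAx].
Qed.

Lemma finite_pigeonhole (T : Type) (A : set T) (f : nat -> T) :
  finite_set A -> (forall n, A (f n)) -> exists i j, (i < j)%N /\ f i = f j.
Proof.
move=> fA Af; apply: contrapT => nf; apply: infinite_nat.
have -> : [set: nat] = f @^-1` A by apply/seteqP; split=> n _ /=; [exact: Af|].
apply: finite_preimage => // i j _ _ fij; apply/eqP; apply: contrapT => /negP.
by rewrite neq_ltn => /orP[] ij; apply: nf; [exists i, j | exists j, i].
Qed.

Lemma finite_image_factor (T U V : Type) (f : T -> U) (g : T -> V) (A : set T) :
  finite_set (f @` A) ->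
  (forall x y, A x -> A y -> f x = f y -> g x = g y) -> finite_set (g @` A).
Proof.
move=> /finite_imageP[B [fB BA Bf]] fg.
apply: sub_finite_set (finite_image g fB) => _ [x Ax <-].
by have [y By fyx] := Bf x Ax; exists y => //; apply: fg => //; apply: BA.
Qed.

Lemma finite_image_map (T U V : Type) (f : T -> U -> V) (s : seq T) (A : set U) :
  (forall i : T, finite_set (f i @` A)) ->
  finite_set ((fun x => [seq f i x | i <- s]) @` A).
Proof.
move=> fA; elim: s => [|i s IHs] /=.
  by apply: sub_finite_set (finite_set1 [::]) => _ [x _ <-].
apply: sub_finite_set (finite_image (fun p => p.1 :: p.2)
  (finite_setX (fA i) IHs)) => _ [x Ax <-].
by exists (f i x, [seq f i x | i <- s]) => //; split; exists x.
Qed.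

Lemma finite_subsets (T : Type) (A : set T) :
  finite_set A -> finite_set [set B : set T | B `<=` A].
Proof.
move=> /(@finite_seqP {classic T})[s sA].
have fF : finite_set [set: (size s).-tuple bool] by exact: finite_finset.
pose F (m : (size s).-tuple bool) : set {classic T} := [set` mask m s].
apply: sub_finite_set (finite_image F fF) => B BA.
exists [tuple of map (fun x : {classic T} => `[< B x >]) (in_tuple s)] => //.
apply/seteqP; split=> x; rewrite /F /= -filter_mask mem_filter.
  by move=> /andP[/asboolP].
move=> Bx; apply/andP; split; first exact/asboolP.
by have := BA x Bx; rewrite sA.
Qed.

Section Subgroups.
Variable G : groupType.
Implicit Types (H K X : set G) (x y : G).

Lemma subgroup1 H : subgroup H -> H 1. Proof. by case. Qed.

Lemma subgroupV H x : subgroup H -> H x -> H x^-1.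
Proof. by move=> [H1 Hd] Hx; rewrite -[x^-1]mul1g; apply: Hd. Qed.

Lemma subgroupM H x y : subgroup H -> H x -> H y -> H (x * y).
Proof. by move=> sH Hx Hy; rewrite -[y]invgK; apply: sH.2 => //; exact: subgroupV. Qed.

Lemma subgroupX H x n : subgroup H -> H x -> H (x ^+ n).
Proof.
move=> sH Hx; elim: n => [|n IHn]; first by rewrite expg0; exact: subgroup1.
by rewrite expgS; exact: subgroupM.
Qed.

Lemma subgroupJ H x y : subgroup H -> H x -> H y -> H (x ^ y).
Proof. by move=> sH Hx Hy; rewrite conjgE; do ?apply: subgroupM => //; exact: subgroupV. Qed.

Lemma subgroupR H x y : subgroup H -> H x -> H y -> H [~ x, y].
Proof.
by move=> sH Hx Hy; rewrite commgEl; apply: subgroupM; [|exact: subgroupV|exact: subgroupJ].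
Qed.

Lemma subgroup_triv : subgroup [set 1 : G].
Proof. by split=> // x y -> ->; rewrite divg1. Qed.

Lemma subgroup_generated (A : set G) : subgroup (generated A).
Proof.
split=> [H [[]] //|x y Ax Ay H HP]; apply: HP.1.2; [exact: Ax|exact: Ay].
Qed.

Lemma generated_in (A : set G) x : A x -> generated A x.
Proof. exact: sub_gen_smallest. Qed.

Lemma generated_min (A : set G) H :
  subgroup H -> A `<=` H -> generated A `<=` H.
Proof. exact: smallest_sub. Qed.

Lemma generated_sub (A B : set G) : A `<=` B -> generated A `<=` generated B.
Proof.
move=> AB; apply: generated_min; first exact: subgroup_generated.
by move=> x /AB; exact: generated_in.
Qed.

Definition cyc x := generated [set x].

Lemma subgroup_cyc x : subgroup (cyc x). Proof. exact: subgroup_generated. Qed.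

Lemma cyc_id x : cyc x x. Proof. exact: generated_in. Qed.

Lemma cyc_min H x : subgroup H -> H x -> cyc x `<=` H.
Proof. by move=> sH Hx; apply: generated_min => // _ ->. Qed.

Lemma commR X H x h : X x -> H h -> commutator_subgroup X H [~ x, h].
Proof. by move=> Xx Hh; apply: generated_in; exists x => //; exists h. Qed.

Lemma subgroup_comm X H : subgroup (commutator_subgroup X H).
Proof. exact: subgroup_generated. Qed.

Lemma comm_min X H K : subgroup K ->
  (forall x h, X x -> H h -> K [~ x, h]) -> commutator_subgroup X H `<=` K.
Proof. by move=> sK XHK; apply: generated_min => // _ [x Xx [h Hh <-]]; exact: XHK. Qed.

Lemma comm_sub X X' H H' : X `<=` X' -> H `<=` H' ->
  commutator_subgroup X H `<=` commutator_subgroup X' H'.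
Proof.
move=> XX HH; apply: comm_min => [|x h Xx Hh]; first exact: subgroup_comm.
by apply: commR; [exact: XX|exact: HH].
Qed.

Lemma subgroup_cent (A : set G) : subgroup [set x | forall y, A y -> commute x y].
Proof.
split=> [y _|x z Cx Cz y Ay]; first exact/commute_sym/commute1.
apply: commute_sym; apply: commuteM; first exact/commute_sym/Cx.
exact/commuteV/commute_sym/Cz.
Qed.

Lemma commgMl x y z : [~ x * y, z] = [~ x, z] ^ y * [~ y, z].
Proof. by rewrite !commgEr conjMg -conjgM (conjVg z y) -[RHS]mulgA mulVKg. Qed.

Lemma commgMr x y z : [~ x, y * z] = [~ x, z] * [~ x, y] ^ z.
Proof. by rewrite !commgEl conjgM (conjMg _ (x ^ y)) conjVg -[RHS]mulgA mulVKg. Qed.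

(** Quotients of two natural powers take the place of integer exponents. *)
Lemma cycP x y : cyc x y -> exists a b : nat, y = x ^+ a / x ^+ b.
Proof.
suff: cyc x `<=` [set y | exists a b : nat, y = x ^+ a / x ^+ b] by exact.
apply: cyc_min; last by exists 1%N, 0%N; rewrite expg0 divg1.
split=> [|_ _ [a [b ->]] [a' [b' ->]]]; first by exists 0, 0; rewrite divgg.
exists (a + b'), (a' + b); rewrite invgF !expgnDr invgM !mulgA.
congr (_ / _); rewrite -!mulgA; congr (_ * _).
by apply: commute_sym; apply: commuteV; apply: commuteX2.
Qed.

Lemma finite_cyc x n : (0 < n)%N -> x ^+ n = 1 -> finite_set (cyc x).
Proof.
move=> n_gt0 xn1; have xm k : x ^+ (n * k) = 1 by rewrite expgnA xn1 expg1n.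
apply: sub_finite_set (finite_image (fun k => x ^+ k) (finite_II n)).
apply: (@subset_trans _ [set y | exists k, y = x ^+ k]).
  apply: cyc_min; last by exists 1%N.
  split=> [|_ _ [a ->] [b ->]]; first by exists 0.
  (* [x ^+ (n.-1 * b)] is the inverse of [x ^+ b], so the natural powers are already closed under
     division. *)
  exists (a + n.-1 * b); rewrite expgnDr; congr (_ * _).
  apply: mulg1_eq; rewrite -expgnDr -mulSn prednK //.
move=> _ [k ->]; exists (k %% n); first by rewrite /= ltn_mod.
by rewrite [in RHS](divn_eq k n) expgnDr mulnC xm mul1g.
Qed.

(* Pigeonhole on the subgroups generated by the x ^+ (2 ^ i) shows that every
   x in H has finite order. *)
Lemma finite_subgroup_of_cyc H :
  subgroup H -> finite_set [set cyc x | x in H] -> finite_set H.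
Proof.
move=> sH fH; apply: (@sub_finite_set _ _ (\bigcup_(C in [set cyc x | x in H]) C)).
  by move=> x Hx; exists (cyc x); [exists x|exact: cyc_id].
apply: bigcup_finite => // _ [x Hx <-].
have [i [j [ij cij]]] : exists i j, (i < j)%N /\
    cyc (x ^+ (2 ^ i)) = cyc (x ^+ (2 ^ j)).
  apply: (finite_pigeonhole (f := fun i => cyc (x ^+ (2 ^ i))) fH) => n.
  by exists (x ^+ (2 ^ n)) => //; exact: subgroupX.
have /cycP[a [b xab]] : cyc (x ^+ (2 ^ j)) (x ^+ (2 ^ i)).
  by rewrite -cij; exact: cyc_id.
have {xab} : x ^+ (2 ^ i + 2 ^ j * b) = x ^+ (2 ^ j * a).
  by rewrite expgnDr xab !expgnA mulgVK.
(* Modulo [2 ^ j] the left side is [2 ^ i], nonzero because [i < j], while the right side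
   vanishes. *)
have ne : (2 ^ i + 2 ^ j * b != 2 ^ j * a)%N.
  apply/negP => /eqP /(congr1 (modn^~ (2 ^ j)%N)).
  rewrite modnMr addnC mulnC modnMDl modn_small ?ltn_exp2l // => /eqP.
  by rewrite expn_eq0.
have xe m n : (m < n)%N -> x ^+ m = x ^+ n -> finite_set (cyc x).
  move=> mn xmn; apply: (@finite_cyc _ (n - m)); first by rewrite subn_gt0.
  by rewrite expgnFr ?xmn ?divgg // ltnW.
by move: ne; rewrite neq_ltn => /orP[] /xe // + xx; apply.
Qed.

End Subgroups.

(** * Finite index and Schur's theorem *)

Section FiniteIndex.
Variable G : groupType.
Implicit Types (H K L : set G) (x y : G).

(* The fibres of f play the role of the cosets of K in H; this makes sense for
   arbitrary sets H and K. *)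
Definition fin_index H K := exists (T : Type) (f : G -> T),
  finite_set (f @` H) /\ forall x y, H x -> H y -> f x = f y -> K (x / y).

Lemma fin_index_sub H K L : K `<=` L -> fin_index H K -> fin_index H L.
Proof.
by move=> KL [T [f [ff fK]]]; exists T, f; split=> // x y Hx Hy /(fK x y Hx Hy)/KL.
Qed.

Lemma fin_index_trans H K L : fin_index H K -> fin_index K L -> fin_index H L.
Proof.
move=> [T [f [ff fK]]] [U [g [fg gL]]].
have [B [fB BH Bf]] := finite_imageP ff.
have /choice[r rP] : forall x, exists y, H x -> B y /\ f y = f x.
  move=> x; have [/Bf[y By fyx]|nHx] := pselect (H x); first by exists y.
  by exists x.
have rK x : H x -> K (x / r x).
  by move=> Hx; have [Br fr] := rP x Hx; apply: fK => //; exact: BH.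
(* The representative [r x] is chosen for each [x] separately and need not be a function of [f x],
   so it is recorded in the label. *)
exists (T * U * G)%type, (fun x => (f x, g (x / r x), r x)); split.
  apply: sub_finite_set (finite_setX (finite_setX ff fg) fB) => _ [x Hx <-].
  have [Br fr] := rP x Hx.
  by do 2?split => //=; [exists x | exists (x / r x) => //; exact: rK].
move=> x y Hx Hy [_ gxy rxy].
have -> : x / y = (x / r x) / (y / r y) by rewrite rxy invgF mulgA mulgVK.
by apply: gL; [exact: rK|exact: rK|].
Qed.

(** The commutator [[~ x, h]] determines the conjugate [x ^ h], so its fibres lie in cosets of the
    centralizer of [x]. *)
Lemma fin_index_cent H x :
  subgroup H -> finite_set [set [~ x, h] | h in H] ->
  fin_index H [set h | H h /\ commute x h].
Proof.
move=> sH fx; exists G, (fun h => [~ x, h]); split=> // y z Hy Hz.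
rewrite !commgEl => /mulgI xyz; split; first exact: sH.2.
by apply/commgP; rewrite -conjg_fix conjgM xyz conjgK.
Qed.

Lemma fin_index_seqI H (I : eqType) (s : seq I) (K : I -> set G) :
  (forall i, i \in s -> fin_index H (K i)) ->
  fin_index H [set x | forall i, i \in s -> K i x].
Proof.
elim: s => [|i s IHs] fK.
  exists unit, (fun=> tt); split=> [|x y _ _ _ i]; last by [].
  by apply: sub_finite_set (finite_set1 tt) => -[].
have [|U [g [fg gK]]] := IHs.
  by move=> j js; apply: fK; rewrite inE js orbT.
have [T [f [ff fKi]]] := fK i (mem_head i s).
exists (T * U)%type, (fun x => (f x, g x)).
split=> [|x y Hx Hy [fxy gxy] j].
  apply: sub_finite_set (finite_setX ff fg) => _ [x Hx <-].
  by split; exists x.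
by rewrite inE => /predU1P[->|js]; [exact: fKi|exact: gK].
Qed.

End FiniteIndex.

(** * Words over a conjugation-closed finite set, and Schur's theorem *)

Section Schur.
Variable G : groupType.
Implicit Types (E S : set G) (x y : G) (w : seq G).

Definition word S w := all (fun x => `[< S x >]) w.

Lemma word_cat S w w' : word S (w ++ w') = word S w && word S w'.
Proof. exact: all_cat. Qed.

(** Moving copies of [s] to the front across a letter [y] replaces [y] by a conjugate, which is
    again a letter, so the length is preserved. *)
Lemma gather_letter S s w n : (forall x y, S x -> S y -> S (x ^ y)) -> S s ->
  word S w -> (n <= count_mem s w)%N -> exists w', [/\ word S w',
    size w = (n + size w')%N & \prod_(x <- w) x = s ^+ n * \prod_(x <- w') x].
Proof.
move=> SJ Ss; elim: w n => [|y w IHw] [|n] //=.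
- by move=> _ _; exists [::]; rewrite !big_nil mul1g.
- by move=> Sw _; exists (y :: w); rewrite mul1g.
case/andP => Sy Sw; case: eqP => [->|_].
  rewrite add1n ltnS => /(IHw n Sw)[w' [Sw' sw' pw']].
  by exists w'; rewrite big_cons pw' expgS mulgA addSn sw'.
rewrite add0n => /(IHw n.+1 Sw)[w' [Sw' sw' pw']].
exists (y ^ (s ^+ n.+1) :: w'); split; rewrite /= ?sw' ?addnS //.
  apply/andP; split=> //; apply/asboolP.
  elim: n.+1 => [|m IHm]; first by rewrite conjg1; exact/asboolP.
  by rewrite expgSr conjgM; exact: SJ.
by rewrite !big_cons pw' mulgA (conjgC y) -[LHS]mulgA.
Qed.

Lemma finite_bounded_words S n : finite_set S ->
  finite_set [set \prod_(x <- w) x | w in [set w | word S w /\ (size w <= n)%N]].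
Proof.
move=> fS; elim: n => [|n IHn].
  apply: sub_finite_set (finite_set1 1) => _ [w [_ sw] <-].
  by move: sw; rewrite leqn0 => /nilP->; rewrite big_nil.
apply: (@sub_finite_set _ _ ([set 1] `|` (fun p => p.1 * p.2) @`
  (S `*` [set \prod_(x <- w) x | w in [set w | word S w /\ (size w <= n)%N]]))).
  move=> _ [[|y w] /= [Sw sw] <-]; first by left; rewrite big_nil.
  right; case/andP: Sw => /asboolP Sy Sw.
  by exists (y, \prod_(x <- w) x); [split => //; exists w | rewrite big_cons].
by rewrite finite_setU; split; [exact: finite_set1|exact/finite_image/finite_setX].
Qed.

Lemma count_mem_sum (w l : seq G) :
  (forall x, x \in w -> x \in l) -> (size w <= \sum_(s <- l) count_mem s w)%N.
Proof.
move=> wl; have -> : size w = count (mem l) w.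
  by apply/esym/eqP; rewrite -all_count; apply/allP => x /wl.
elim: l {wl} => [|s l IHl]; first by rewrite big_nil (eq_count (a2 := pred0)) ?count_pred0 //.
rewrite big_cons; apply: leq_trans (leq_add (leqnn _) IHl).
by rewrite -count_predUI (eq_count (a2 := predU (pred1 s) (mem l))) ?leq_addr.
Qed.

(* A word of minimal length contains each letter s at most n times if s ^+ n.+1
   is a product of n letters, since the letters s can be moved to the front. *)
Lemma finite_generated_words S : finite_set S ->
  (forall x, S x -> S x^-1) -> (forall x y, S x -> S y -> S (x ^ y)) ->
  (forall s, S s -> exists w, word S w /\ s ^+ (size w).+1 = \prod_(x <- w) x) ->
  finite_set (generated S).
Proof.
move=> fS SV SJ Sw.
have /choice[u uP] : forall s, exists w, S s ->
    word S w /\ s ^+ (size w).+1 = \prod_(x <- w) x.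
  by move=> s; have [/Sw[w Pw]|nSs] := pselect (S s); [exists w|exists [::]].
have [l Sl] := (finite_seqP S).1 fS.
pose N := (\sum_(s <- l) size (u s))%N.
apply: sub_finite_set (finite_bounded_words N fS) => x Sx.
have exw : exists w, word S w /\ x = \prod_(y <- w) y.
  suff: generated S `<=` [set x | exists w, word S w /\ x = \prod_(y <- w) y].
    by move/(_ x Sx).
  apply: generated_min => [|y Sy]; last first.
    by exists [:: y]; rewrite big_seq1 /= andbT; split=> //; apply/asboolP.
  split=> [|_ _ [w [ww ->]] [w' [ww' ->]]]; first by exists [::]; rewrite big_nil.
  exists (w ++ rev [seq y^-1 | y <- w']); rewrite word_cat ww /= big_cat.
  split; last by rewrite -map_rev big_map prodgV revK.
  rewrite /word all_rev all_map; apply/allP => y /(allP ww')/asboolP Sy.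
  exact/asboolP/SV.
pose P n := `[< exists w, [/\ word S w, x = \prod_(y <- w) y & size w = n] >].
have exP : exists n, P n by case: exw => w [? ?]; exists (size w); apply/asboolP; exists w.
case: (ex_minnP exP) => n /asboolP[w [ww xw sw]] nmin.
exists w => //; split => //.
have wl y : y \in w -> y \in l.
  by move=> /(allP ww)/asboolP; rewrite Sl.
apply: leq_trans (count_mem_sum wl) _.
rewrite /N [X in (X <= _)%N]big_seq [X in (_ <= X)%N]big_seq; apply: leq_sum => s sl.
have Ss : S s by rewrite Sl.
rewrite leqNgt; apply/negP => ltw.
have [w' [ww' sw' pw']] := gather_letter SJ Ss ww ltw.
have [wu pu] := uP s Ss.
suff: (n <= size (u s) + size w')%N by rewrite -sw sw' addSn ltnn.
apply: nmin; apply/asboolP; exists (u s ++ w'); rewrite word_cat wu ww' size_cat.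
by split=> //; rewrite big_cat /= -pu xw pw'.
Qed.

(** A commutator depends on its entries only modulo the centre, so there are finitely many of them.
    They are closed under inverses and conjugation, and a power of each is a shorter product of
    commutators. *)
Lemma Schur_finite_derived E : subgroup E ->
  fin_index E [set c | E c /\ forall e, E e -> commute c e] ->
  finite_set (commutator_subgroup E E).
Proof.
move=> sE [T [f [ff fE]]]; apply: finite_generated_words.
- pose g (p : G * G) := (f p.1, f p.2).
  apply: (@sub_finite_set _ _ ((fun p : G * G => [~ p.1, p.2]) @` (E `*` E))).
    by move=> _ [x Ex [y Ey <-]]; exists (x, y).
  apply: (finite_image_factor (f := g)).
    apply: sub_finite_set (finite_setX ff ff) => _ [[x y] [/= Ex Ey] <-].
    by split; [exists x|exists y].
  move=> [x y] [x' y'] [/= Ex Ey] [/= Ex' Ey'] [/(fE _ _ Ex Ex')[_ zx] /(fE _ _ Ey Ey')[_ zy]].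
  (* Write [x] as [(x / x') * x'] with central first factor, and likewise [y]; the central factors
     drop out of the commutator. *)
  rewrite -[x](mulgVK x') -[y](mulgVK y') /= !mulgVK.
  rewrite -[x in LHS](mulgVK x') commgMl.
  have /commgP/eqP -> := zx y Ey; rewrite conj1g mul1g.
  rewrite -[y in LHS](mulgVK y') commgMr.
  have /commute_sym/commgP/eqP -> := zy x' Ex'; rewrite conj1g mulg1 //.
- move=> _ [x Ex [y Ey <-]]; rewrite invgR; exists y => //; exists x => //.
- move=> _ _ [x Ex [y Ey <-]] [x' Ex' [y' Ey' <-]]; rewrite conjRg.
  have Ez : E [~ x', y'] by exact: subgroupR.
  by exists (x ^ [~ x', y']); [|exists (y ^ [~ x', y'])]; rewrite //; exact: subgroupJ.
move=> _ [a Ea [b Eb <-]].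
have Ec : E [~ a, b] by exact: subgroupR.
(* Two powers of [[~ a, b]] agree modulo the centre, hence some positive power is central. *)
have [i [j [ij fij]]] := finite_pigeonhole (f := fun n => f ([~ a, b] ^+ n)) ff
   (fun n => ex_intro2 _ _ _ (subgroupX n sE Ec) erefl).
pose n := (j - i).-1; have jn : (j - i)%N = n.+1 by rewrite prednK ?subn_gt0.
have cn : commute ([~ a, b] ^+ n.+1) b.
  have [_ /(_ b Eb)] := fE _ _ (subgroupX j sE Ec) (subgroupX i sE Ec) (esym fij).
  by rewrite -expgnFr ?jn // ltnW.
(* [~ a, b] ^+ n.+2 = [~ a, b * b] * ([~ a, b] ^ b) ^+ n, because b centralizes
   [~ a, b] ^+ n.+1. *)
exists ([~ a, b * b] :: nseq n ([~ a, b] ^ b)); split.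
  apply/andP; split; first by apply/asboolP; exists a => //; exists (b * b) => //; exact: subgroupM.
  apply/allP => x /nseqP[-> _]; apply/asboolP; rewrite conjRg.
  by exists (a ^ b); [exact: subgroupJ|exists (b ^ b) => //; exact: subgroupJ].
rewrite big_cons /= size_nseq big_nseq iter_mulg_1 commgMr -mulgA -expgS -conjXg.
by rewrite expgS; congr (_ * _); apply/esym/conjg_fixP/commgP.
Qed.

End Schur.

(** * Sections E/N *)

Section SectionGroup.
Variables (G : groupType) (E N : set G).
Hypotheses (sE : subgroup E) (nN : normal_in N E).

Let sN : subgroup N. Proof. by case: nN. Qed.

(** The choice depends only on the left coset as a set, so equal cosets receive the same
    representative. *)
Definition coset_repr (x : G) : G := xget 1 [set x * y | y in N].

Lemma coset_reprP x : N (x^-1 * coset_repr x).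
Proof.
rewrite /coset_repr; case: xgetP => [z _ [y Ny <-]|]; first by rewrite mulKg.
by move/(_ x); case; exists 1; [exact: subgroup1|rewrite mulg1].
Qed.

Lemma coset_repr_eq x y : N (x^-1 * y) -> coset_repr x = coset_repr y.
Proof.
move=> Nxy; rewrite /coset_repr; congr (xget 1 _); apply/seteqP; split=> _ [z Nz <-].
  exists ((x^-1 * y)^-1 * z); last by rewrite invgM invgK !mulgA mulgV mul1g.
  by apply: subgroupM => //; exact: subgroupV.
by exists (x^-1 * y * z); [exact: subgroupM|rewrite !mulgA mulgV mul1g].
Qed.

Lemma E_coset_repr x : E x -> E (coset_repr x).
Proof.
case: nN => _ NE _ Ex; rewrite -(mulVKg x (coset_repr x)).
by apply: subgroupM => //; exact/NE/coset_reprP.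
Qed.

Lemma coset_reprK x : coset_repr (coset_repr x) = coset_repr x.
Proof.
apply: coset_repr_eq; rewrite -[_ * x]invgK invgM invgK.
by apply: subgroupV => //; exact: coset_reprP.
Qed.

(** The carrier of [E]/[N] consists of the chosen representatives lying in [E]. *)
Definition section_type := {x : G | `[< E x /\ coset_repr x = x >]}.

HB.instance Definition _ := Choice.on section_type.

Lemma section_subproof x : E x -> `[< E (coset_repr x) /\
  coset_repr (coset_repr x) = coset_repr x >].
Proof. by move=> Ex; apply/asboolP; rewrite coset_reprK; split=> //; exact: E_coset_repr. Qed.

(** Elements outside [E] are sent to the trivial coset to make the map total. *)
Definition to_section (x : G) : section_type :=
  match pselect (E x) with
  | left Ex => exist _ (coset_repr x) (section_subproof Ex)
  | right _ => exist _ (coset_repr 1) (section_subproof (subgroup1 sE))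
  end.

Lemma val_to_section x : E x -> val (to_section x) = coset_repr x.
Proof. by rewrite /to_section; case: pselect. Qed.

Lemma section_valP (u : section_type) : E (val u) /\ coset_repr (val u) = val u.
Proof. exact/asboolP/(valP u). Qed.

Lemma to_section_val u : to_section (val u) = u.
Proof. by have [Eu ru] := section_valP u; apply: val_inj; rewrite val_to_section. Qed.

Lemma to_section_eq x y : E x -> E y -> N (x^-1 * y) -> to_section x = to_section y.
Proof.
by move=> Ex Ey Nxy; apply: val_inj; rewrite !val_to_section //; exact: coset_repr_eq.
Qed.

Definition section_mul (u v : section_type) := to_section (val u * val v).

Lemma to_sectionM x y : E x -> E y ->
  to_section (x * y) = section_mul (to_section x) (to_section y).
Proof.
case: (nN) => _ NE NJ Ex Ey; rewrite /section_mul !val_to_section //.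
have Exy := subgroupM sE Ex Ey.
have Ex' := E_coset_repr Ex; have Ey' := E_coset_repr Ey.
apply: to_section_eq => //; first exact: subgroupM.
have -> : (x * y)^-1 * (coset_repr x * coset_repr y) =
    (x^-1 * coset_repr x) ^ y * (y^-1 * coset_repr y).
  by rewrite conjgE invgM !mulgA mulgK.
by apply: subgroupM => //; [apply: NJ => //|]; exact: coset_reprP.
Qed.

Lemma section_mulA : associative section_mul.
Proof.
move=> u v w; rewrite -(to_section_val u) -(to_section_val v) -(to_section_val w).
have [[[Eu _] [Ev _]] [Ew _]] := (section_valP u, section_valP v, section_valP w).
have [Euv Evw] := (subgroupM sE Eu Ev, subgroupM sE Ev Ew).
rewrite -(to_sectionM Eu Ev) -(to_sectionM Ev Ew).
by rewrite -(to_sectionM Eu Evw) -(to_sectionM Euv Ew) mulgA.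
Qed.

Lemma section_mul1 : left_id (to_section 1) section_mul.
Proof.
move=> u; rewrite -(to_section_val u); have [Eu _] := section_valP u.
by rewrite -(to_sectionM (subgroup1 sE) Eu) mul1g.
Qed.

Lemma section_1mul : right_id (to_section 1) section_mul.
Proof.
move=> u; rewrite -(to_section_val u); have [Eu _] := section_valP u.
by rewrite -(to_sectionM Eu (subgroup1 sE)) mulg1.
Qed.

Definition section_inv (u : section_type) := to_section (val u)^-1.

Lemma section_mulV : left_inverse (to_section 1) section_inv section_mul.
Proof.
move=> u; rewrite -{2}(to_section_val u); have [Eu _] := section_valP u.
by rewrite -(to_sectionM (subgroupV sE Eu) Eu) mulVg.
Qed.

Lemma section_Vmul : right_inverse (to_section 1) section_inv section_mul.
Proof.
move=> u; rewrite -{1}(to_section_val u); have [Eu _] := section_valP u.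
by rewrite -(to_sectionM Eu (subgroupV sE Eu)) mulgV.
Qed.

HB.instance Definition _ := isGroup.Build section_type section_mulA
  section_mul1 section_1mul section_mulV section_Vmul.

End SectionGroup.

Lemma section_group (G : groupType) (E N : set G) :
  subgroup E -> normal_in N E -> exists (Q : groupType) (f : G -> Q),
    [/\ {in E &, {morph f : x y / x * y}}, f @` E = setT &
        forall x, E x -> f x = 1 <-> N x].
Proof.
move=> sE nN; exists (section_type E N), (to_section sE nN); split.
- by move=> x y /set_mem Ex /set_mem Ey; exact: to_sectionM.
- apply/seteqP; split=> // u _; exists (val u); last exact: to_section_val.
  by have [] := section_valP u.
move=> x Ex; have E1 := subgroup1 sE; have [sN _ _] := nN.
split=> [/(congr1 val)|Nx]; last first.
  by apply: to_section_eq => //; rewrite mulg1; exact: subgroupV.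
rewrite !val_to_section // => x1.
have := coset_reprP nN x; rewrite x1 => Nx1.
have N1 : N (coset_repr N 1) by have := coset_reprP nN 1; rewrite invg1 mul1g.
rewrite -[x]invgK; apply: subgroupV => //.
by rewrite -[x^-1](mulgK (coset_repr N 1)); exact: sN.2.
Qed.

(** * Homomorphisms defined on a subgroup, and images of groups with Kbar *)

Section MorphOn.
Variables (G Q : groupType) (E : set G) (f : G -> Q).
Hypotheses (sE : subgroup E) (fM : {in E &, {morph f : x y / x * y}}).

Lemma morph_onM x y : E x -> E y -> f (x * y) = f x * f y.
Proof. by move=> Ex Ey; apply: fM; exact: mem_set. Qed.

Lemma morph_on1 : f 1 = 1.
Proof.
have E1 := subgroup1 sE; apply: (@mulgI _ (f 1)).
by rewrite -morph_onM // !mulg1.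
Qed.

Lemma morph_onV x : E x -> f x^-1 = (f x)^-1.
Proof.
move=> Ex; apply/esym/mulg1_eq; rewrite -morph_onM ?mulgV ?morph_on1 //.
exact: subgroupV.
Qed.

Lemma morph_onJ x y : E x -> E y -> f (x ^ y) = f x ^ f y.
Proof.
move=> Ex Ey; rewrite !conjgE !morph_onM ?morph_onV //; first exact: subgroupV.
exact: subgroupM.
Qed.

Lemma morph_onR x y : E x -> E y -> f [~ x, y] = [~ f x, f y].
Proof.
move=> Ex Ey; rewrite !commgEl morph_onM ?morph_onV ?morph_onJ //; first exact: subgroupV.
exact: subgroupJ.
Qed.

Lemma subgroup_image H : subgroup H -> H `<=` E -> subgroup (f @` H).
Proof.
move=> sH HE; split=> [|_ _ [x Hx <-] [y Hy <-]].
  by exists 1; [exact: subgroup1|exact: morph_on1].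
exists (x / y); first exact: sH.2.
rewrite morph_onM ?morph_onV //; do ?[exact: HE]; apply: subgroupV => //; exact: HE.
Qed.

Lemma subgroup_preimage H : subgroup H -> subgroup (E `&` f @^-1` H).
Proof.
move=> sH; split=> [|x y [Ex Hx] [Ey Hy]].
  by split; [exact: subgroup1|rewrite /= morph_on1; exact: subgroup1].
split; first exact: sE.2.
rewrite /= morph_onM ?morph_onV //; last exact: subgroupV.
exact: sH.2.
Qed.

Hypothesis f_onto : f @` E = setT.

(** Taking full preimages in [E] expresses commutator subgroups of [Q] through those of [G], which
    is how Kbar passes to sections. *)
Lemma comm_image (X H : set Q) :
  commutator_subgroup X H =
  f @` commutator_subgroup (E `&` f @^-1` X) (E `&` f @^-1` H).
Proof.
have CE : commutator_subgroup (E `&` f @^-1` X) (E `&` f @^-1` H) `<=` E.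
  by apply: comm_min => // x h [Ex _] [Eh _]; exact: subgroupR.
apply/seteqP; split.
  apply: comm_min; first by apply: subgroup_image => //; exact: subgroup_comm.
  move=> u v Xu Hv.
  have [x Ex xu] : (f @` E) u by rewrite f_onto.
  have [h Eh hv] : (f @` E) v by rewrite f_onto.
  exists [~ x, h]; last by rewrite morph_onR // xu hv.
  by apply: commR; split; rewrite //= ?xu ?hv.
move=> _ [g Cg <-]; suff: (E `&` f @^-1` commutator_subgroup X H) g by case.
move: g Cg; apply: comm_min; first exact/subgroup_preimage/subgroup_comm.
move=> x h [Ex Xx] [Eh Hh]; split; first exact: subgroupR.
by rewrite /= morph_onR //; exact: commR.
Qed.

Lemma property_Kbar_image : property_Kbar G -> property_Kbar Q.
Proof.
move=> KG X sX; have := KG _ (subgroup_preimage sX) => fX.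
apply: sub_finite_set (finite_image (fun L => f @` L) fX) => _ [H sH <-].
exists (commutator_subgroup (E `&` f @^-1` X) (E `&` f @^-1` H)).
  by exists (E `&` f @^-1` H) => //; exact: subgroup_preimage.
by rewrite -comm_image.
Qed.

End MorphOn.

(** * Cyclic modules over int[t, 1/t] *)

Section CyclicModules.
Import GRing.Theory Num.Theory.
Local Open Scope ring_scope.
Variables (V : zmodType) (t t' : V -> V).
Hypotheses (tB : {morph t : u v / u - v}) (tK : cancel t t') (t'K : cancel t' t).
Implicit Types (f g : {poly int}) (u v z : V) (Y : set V).

HB.instance Definition _ := GRing.isZmodMorphism.Build V V t tB.

Lemma t'B : {morph t' : u v / u - v}.
Proof. by move=> u v; apply: (can_inj tK); rewrite tB !t'K. Qed.

HB.instance Definition _ := GRing.isZmodMorphism.Build V V t' t'B.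

(** Subgroups stable under [t] and its inverse [t'] are the submodules over the Laurent polynomials
    in [t]; [tspan v] is the cyclic submodule of [v]. *)
Definition zsub Y := Y 0 /\ forall u v, Y u -> Y v -> Y (u - v).
Definition tstable Y := forall u, Y u -> Y (t u) /\ Y (t' u).
Definition tspan v := smallest (fun Y => zsub Y /\ tstable Y) [set v].

Lemma tspan_id v : tspan v v.
Proof. exact: sub_gen_smallest. Qed.

Lemma tspan_zsub v : zsub (tspan v).
Proof.
split=> [Y [[[]]]//|u w su sw Y YP].
by apply: YP.1.1.2; [exact: su|exact: sw].
Qed.

Lemma tspan_tstable v : tstable (tspan v).
Proof.
by move=> u su; split=> Y YP; have [] := YP.1.2 u (su Y YP).
Qed.

Lemma tspan_min v Y : zsub Y -> tstable Y -> Y v -> tspan v `<=` Y.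
Proof. by move=> sY tY Yv; apply: smallest_sub => // _ ->. Qed.

Section Zsub.
Variables (Y : set V) (sY : zsub Y).
Lemma zsub0 : Y 0. Proof. by case: sY. Qed.
Lemma zsubB u v : Y u -> Y v -> Y (u - v). Proof. by case: sY => _; exact. Qed.
Lemma zsubN u : Y u -> Y (- u).
Proof. by move=> Yu; rewrite -sub0r; apply: zsubB => //; exact: zsub0. Qed.
Lemma zsubD u v : Y u -> Y v -> Y (u + v).
Proof. by move=> Yu Yv; rewrite -[v]opprK; apply: zsubB => //; exact: zsubN. Qed.
Lemma zsubMn u n : Y u -> Y (u *+ n).
Proof.
move=> Yu; elim: n => [|n IHn]; first by rewrite mulr0n; exact: zsub0.
by rewrite mulrS; exact: zsubD.
Qed.
Lemma zsubMz u (c : int) : Y u -> Y (u *~ c).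
Proof.
case: c => n Yu; first by rewrite -pmulrn; exact: zsubMn.
by rewrite NegzE mulrNz -pmulrn; apply: zsubN; exact: zsubMn.
Qed.
Lemma zsub_sum (I : Type) (r : seq I) (P : pred I) (F : I -> V) :
  (forall i, P i -> Y (F i)) -> Y (\sum_(i <- r | P i) F i).
Proof.
by move=> YF; apply: (big_ind Y) => //; [exact: zsub0|exact: zsubD].
Qed.
End Zsub.

Lemma iter_tB n : {morph iter n t : u v / u - v}.
Proof. by move=> u v; elim: n => //= n ->; rewrite raddfB. Qed.

Lemma iter_tMz n u (c : int) : iter n t (u *~ c) = iter n t u *~ c.
Proof. by elim: n => //= n ->; rewrite raddfMz. Qed.

Lemma tstable_iter Y u n : tstable Y -> Y u -> Y (iter n t u).
Proof. by move=> tY Yu; elim: n => //= n /tY[]. Qed.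

(** This is f(t) applied to [v]. *)
Definition act f v := \sum_(i < size f) iter i t v *~ f`_i.

Lemma act_wide f v n : (size f <= n)%N -> act f v = \sum_(i < n) iter i t v *~ f`_i.
Proof.
move=> fn; rewrite /act (big_ord_widen n (fun i => iter i t v *~ f`_i)) //.
rewrite big_mkcond; apply: eq_bigr => i _; case: ltnP => // /(nth_default 0) ->.
by rewrite mulr0z.
Qed.

Lemma actB f g v : act (f - g) v = act f v - act g v.
Proof.
pose n := maxn (size f) (size g).
have fn : (size f <= n)%N by exact: leq_maxl.
have gn : (size g <= n)%N by exact: leq_maxr.
have fgn : (size (f - g)%R <= n)%N.
  by apply: leq_trans (size_polyD _ _) _; rewrite size_polyN.
rewrite !(@act_wide _ _ n) // -sumrB; apply: eq_bigr => i _.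
by rewrite coefB mulrzBr.
Qed.

Lemma actZ (c : int) f v : act (c *: f) v = act f v *~ c.
Proof.
rewrite (@act_wide _ _ (size f)) ?size_scale_leq // /act mulrz_suml.
by apply: eq_bigr => i _; rewrite coefZ mulrC mulrzA.
Qed.

Lemma act_tX f v : act (f * 'X) v = t (act f v).
Proof.
rewrite (@act_wide _ _ (size f).+1); last first.
  by apply: leq_trans (size_polyMleq _ _) _; rewrite size_polyX addn2.
rewrite big_ord_recl coefMX mulr0z add0r /act raddf_sum; apply: eq_bigr => i _.
by rewrite coefMX /= raddfMz.
Qed.

Lemma actC (c : int) v : act c%:P v = v *~ c.
Proof. by rewrite (@act_wide _ _ 1) ?size_polyC_leq1 // big_ord1 coefC. Qed.

Lemma actXn v n : act 'X^n v = iter n t v.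
Proof.
elim: n => [|n IHn]; first by rewrite expr0 (actC 1).
by rewrite exprSr act_tX IHn.
Qed.

Lemma act_subr f u v : act f (u - v) = act f u - act f v.
Proof.
by rewrite /act -sumrB; apply: eq_bigr => i _; rewrite iter_tB mulrzBl.
Qed.

Lemma act_t f v : act f (t v) = t (act f v).
Proof.
rewrite /act raddf_sum; apply: eq_bigr => i _.
by rewrite raddfMz -iterSr.
Qed.

Lemma act_Mn f v n : act f (v *+ n) = act f v *+ n.
Proof.
rewrite /act -sumrMnl; apply: eq_bigr => i _.
by rewrite pmulrn iter_tMz pmulrn mulrzAC.
Qed.

(* For q = 0 this describes the linear dependence over int of the iterates of v
   under t modulo Y, and for q prime the dependence over the field of q elements.
   Here d is the least degree of a relation and c the product of its extreme
   coefficients, whose invertibility expresses all iterates through the first d. *)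
Lemma relation_mod (q : nat) v Y : (q == 0%N) || prime q -> zsub Y -> tstable Y ->
  Y (v *+ q) -> forall f i, Y (act f v) -> ~~ (q %| f`_i)%Z ->
  exists (d : nat) (c : int), [/\ ~~ (q %| c)%Z,
    forall g, (size g <= d)%N -> Y (act g v) -> forall i, (q %| g`_i)%Z &
    forall z, tspan v z -> exists N g, (size g <= d)%N /\ Y (z *~ (c ^+ N) - act g v)].
Proof.
move=> q_pr sY tY Yqv f0 i0 Yf0 qf0.
have qM (a b : int) : (q %| a * b)%Z -> (q %| a)%Z || (q %| b)%Z.
  case/orP: q_pr => [/eqP->|pq]; first by rewrite !dvd0z mulf_eq0.
  by rewrite !dvdzE abszM Euclid_dvdM.
pose P n := `[< exists f i, [/\ (size f <= n)%N, Y (act f v) & ~~ (q %| f`_i)%Z] >].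
have exP : exists n, P n by exists (size f0); apply/asboolP; exists f0, i0.
case: (ex_minnP exP) => n /asboolP[f [i [fn Yf qf]]] nmin.
have {f0 i0 Yf0 qf0 exP} nmin d g : (d < n)%N -> (size g <= d)%N -> Y (act g v) ->
    forall j, (q %| g`_j)%Z.
  move=> dn gd Yg j; apply/negPn/negP => qg; move: dn; rewrite ltnNge nmin //.
  by apply/asboolP; exists g, j.
case: n fn nmin => [|d] fd nmin.
  by move: fd qf; rewrite leqn0 => /nilP->; rewrite nth_nil dvdz0.
have {}nmin := nmin d _ (ltnSn d).
have Yq (a : int) u : Y (u *+ q) -> (q %| a)%Z -> Y (u *~ a).
  move=> Yu /dvdzP[b ->]; rewrite mulrC mulrzA -pmulrn; exact: zsubMz.
have Yqt k : Y (iter k t v *+ q).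
  by rewrite pmulrn -iter_tMz -pmulrn; exact: tstable_iter.
(* If [q] divided the coefficient of degree [d], dropping that term would leave a shorter relation
   that is still nontrivial modulo [q]. *)
have qfd : ~~ (q %| f`_d)%Z.
  apply/negP => qd; have Yg : Y (act (f - f`_d *: 'X^d) v).
    by rewrite actB actZ actXn; apply: zsubB => //; exact: Yq.
  have/nmin : (size (f - f`_d *: 'X^d)%R <= d)%N.
    apply/leq_sizeP => j; rewrite leq_eqVlt coefB coefZ coefXn => /predU1P[<-|dj].
      by rewrite eqxx mulr1 subrr.
    by rewrite gtn_eqF // mulr0 subr0 nth_default // (leq_trans fd).
  move=> /(_ Yg i); rewrite coefB coefZ coefXn; case: eqP => [id|_].
    by move: qf; rewrite id qd.
  by rewrite mulr0 subr0; exact/negP.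
have shift g : (size g <= d.+1)%N -> g`_0 = 0 ->
    exists2 h : {poly int}, (size h <= d)%N & g = h * 'X.
  move=> gd g0; exists (\poly_(i < d) g`_i.+1); first exact: size_poly.
  apply/polyP => -[|j]; rewrite coefMX //= coef_poly; case: ltnP => // dj.
  by rewrite nth_default // (leq_trans gd).
(* If [q] divided the constant coefficient, dropping it and dividing by the invertible [t] would
   give a shorter nontrivial relation. *)
have qf0 : ~~ (q %| f`_0)%Z.
  apply/negP => q0; have Yg : Y (act (f - (f`_0)%:P) v).
    by rewrite actB actC; apply: zsubB => //; exact: Yq.
  have [||h hd fh] := shift (f - (f`_0)%:P).
  - apply/leq_sizeP => j dj; rewrite coefB coefC nth_default ?(leq_trans fd) //.
    by case: j dj => // j _; rewrite subr0.
  - by rewrite coefB coefC subrr.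
  have Yh : Y (act h v) by rewrite -[act h v]tK -act_tX -fh; case: (tY _ Yg).
  have : (q %| (f - (f`_0)%:P)`_i)%Z.
    by rewrite fh coefMX; case: eqP => // _; exact: nmin.
  by rewrite coefB coefC; case: eqP => [i0|_]; [move: qf; rewrite i0 q0|rewrite subr0; exact/negP].
pose L z := exists g, (size g <= d)%N /\ Y (z - act g v).
have sL : zsub L.
  split=> [|u w [g [gd Yg]] [h [hd Yh]]].
    exists 0; rewrite size_poly0 -(scale0r 0) actZ mulr0z subr0; split=> //.
    exact: zsub0.
  exists (g - h); split.
    by rewrite (leq_trans (size_polyD _ _)) // size_polyN geq_max gd.
  by rewrite actB opprB [act h v - _]addrC addrACA [- w + _]addrC -(opprB w); exact: zsubB.
have YL u : Y u -> L u.
  by move=> Yu; exists 0; rewrite size_poly0 -(scale0r 0) actZ mulr0z subr0.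
pose c : int := f`_0 * f`_d.
(* After scaling by the coefficient of degree [d], the relation [f] eliminates the top term produced
   by [t]; after scaling by the constant coefficient, it eliminates the constant term before [t'] is
   applied. *)
have tL u : L u -> L (t u *~ c) /\ L (t' u *~ c).
  move=> [g [gd Yg]].
  have Ytg : Y (t u - act (g * 'X) v) by rewrite act_tX -raddfB; case: (tY _ Yg).
  split.
    rewrite /c mulrC mulrzA; apply: zsubMz => //.
    exists (f`_d *: (g * 'X) - (g * 'X)`_d *: f); split.
      apply/leq_sizeP => j; rewrite leq_eqVlt coefB !coefZ => /predU1P[<-|dj].
        by rewrite mulrC subrr.
      rewrite (nth_default 0 (leq_trans fd dj)) mulr0 subr0 coefMX.
      by case: j dj => // j dj; rewrite /= (nth_default 0 (leq_trans gd (dj : (d <= j)%N))) mulr0.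
    rewrite actB !actZ opprB addrCA -mulrzBl addrC.
    by apply: zsubD => //; exact: zsubMz.
  rewrite /c mulrzA; apply: zsubMz => //.
  have [||h hd fh] := shift (f`_0 *: g - g`_0 *: f).
  - rewrite (leq_trans (size_polyD _ _)) // size_polyN geq_max.
    by rewrite !(leq_trans (size_scale_leq _ _)) // (leq_trans gd).
  - by rewrite coefB !coefZ mulrC subrr.
  exists h; split=> //.
  have -> : act h v = t' (act g v *~ f`_0 - act f v *~ g`_0).
    by rewrite -!actZ -actB fh act_tX tK.
  rewrite -raddfMz -raddfB opprB addrCA -mulrzBl addrC.
  suff: Y (((u - act g v) *~ f`_0 + act f v *~ g`_0)) by case/tY.
  by apply: zsubD => //; exact: zsubMz.
exists d, c; split=> //.
  by apply/negP => /qM /orP[]; exact/negP.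
pose M z := exists N, L (z *~ c ^+ N).
suff : tspan v `<=` M by move=> vM z /vM[N [g [gd Yg]]]; exists N, g.
apply: tspan_min.
- split=> [|u w [N LN] [K LK]]; first by exists 0; rewrite mul0rz; exact: zsub0.
  exists (N + K)%N; rewrite mulrzBl {1}exprD addnC exprD !mulrzA.
  by apply: zsubB => //; exact: zsubMz.
- move=> u [N /tL[Lt Lt']].
  by split; exists N.+1; rewrite exprSr mulrzA; rewrite -(raddfMz t) || rewrite -(raddfMz t').
(* For [d = 0] the relation [f] is constant and puts a multiple of [v] into [Y]; otherwise [v]
   itself is given by the polynomial 1. *)
case: (posnP d) => [d0|d_gt0].
  exists 1%N; rewrite expr1 /c mulrzA; apply: zsubMz => //; apply: YL.
  by rewrite -actC -size1_polyC // -[1%N]/0.+1 -d0.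
exists 0, 1; rewrite size_poly1 expr0 mulr1z; split=> //.
by rewrite -(expr0 'X) actXn subrr; exact: zsub0.
Qed.

Lemma mulrz_absz0 v (m : int) : v *~ m = 0 -> v *+ `|m| = 0.
Proof.
by case: m => n //; rewrite NegzE mulrNz abszN => /eqP; rewrite oppr_eq0 => /eqP.
Qed.

(* A prime p not dividing the constant c of [relation_mod] for q = 0 cannot satisfy
   p ^ k v = p ^ k.+1 z unless v is torsion. *)
Lemma torsion v f : f != 0 -> act f v = 0 ->
  (forall p, prime p -> exists k z, tspan v z /\ v *+ p ^ k = z *+ p ^ k.+1) ->
  exists2 n, (0 < n)%N & v *+ n = 0.
Proof.
move=> f0 fv vp; have sY : zsub [set (0 : V)].
  by split=> // u w -> ->; rewrite subr0.
have tY : tstable [set (0 : V)] by move=> u ->; rewrite !raddf0.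
have lf : ~~ (0%N %| f`_(size f).-1)%Z by rewrite dvd0z -lead_coefE lead_coef_eq0.
have [|d [c [c0 ind sp]]] := @relation_mod 0 v _ isT sY tY _ f _ fv lf.
  by rewrite mulr0n.
have {}c0 : c != 0 by rewrite dvd0z in c0.
have [p pc p_pr] := prime_above `|c|.
have [k [z [vz pz]]] := vp p p_pr.
have [N [g [gd /eqP]]] := sp z vz; rewrite subr_eq0 => /eqP zg.
have rel : act ((c ^+ N * (p ^ k)%N%:Z)%:P - (p ^ k.+1)%N%:Z *: g)%R v = 0.
  have pz' : v *~ (p ^ k)%N%:Z = z *~ (p ^ k.+1)%N%:Z by exact: pz.
  by rewrite actB actC actZ -zg (mulrC (c ^+ N)) mulrzA pz' mulrzAC subrr.
(* For [d = 0] the polynomial [g] is zero and the relation itself says that [v] is torsion. *)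
case: (posnP d) => [d0|d_gt0].
  have g0 : g = 0 by apply/eqP; rewrite -size_poly_leq0 -d0.
  move: rel; rewrite g0 scaler0 subr0 actC => rel.
  exists `|(c ^+ N * (p ^ k)%N%:Z)%R|%N; last exact: mulrz_absz0.
  by rewrite absz_gt0 mulf_neq0 ?expf_neq0 // -lt0n expn_gt0 prime_gt0.
(* This polynomial has size at most [d], so minimality makes its coefficients zero; the constant one
   yields that [p] divides a power of [c], although [p] exceeds the absolute value of [c]. *)
have := ind ((c ^+ N * (p ^ k)%N%:Z)%:P - (p ^ k.+1)%N%:Z *: g) _ rel 0%N.
rewrite dvd0z coefB coefC coefZ subr_eq0 => /(_ _)/eqP cp.
have {}cp : c ^+ N * (p ^ k)%N%:Z = (p ^ k.+1)%N%:Z * g`_0.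
  apply: cp; rewrite (leq_trans (size_polyD _ _)) // size_polyN geq_max.
  by rewrite (leq_trans (size_polyC_leq1 _)) // (leq_trans (size_scale_leq _ _)).
have : (p %| `|c| ^ N)%N.
  have pk : (0 < p ^ k)%N by rewrite expn_gt0 prime_gt0.
  rewrite -(dvdn_pmul2r pk) -expnS; apply/dvdnP; exists (absz g`_0%R).
  by have := congr1 absz cp; rewrite !abszM abszX mulnC => ->; rewrite mulnC.
rewrite Euclid_dvdX // => /andP[pc' _].
by have := dvdn_leq _ pc'; rewrite absz_gt0 c0 leqNgt pc => /(_ isT).
Qed.

(** Induction on [n]: for a prime [p] dividing [n] the span of [v *+ p] is finite. Modulo it, the
    coefficient 1 of [f] gives a relation nontrivial modulo [p], so the span of [v] consists of
    combinations of finitely many iterates with coefficients below [p]. *)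
Lemma finite_tspan v f i n : (0 < n)%N -> v *+ n = 0 -> act f v = 0 -> f`_i = 1 ->
  finite_set (tspan v).
Proof.
move=> + + + fi; elim/ltn_ind: n v => n IHn v n_gt0 vn fv.
have [n1|n_gt1] := leqP n 1.
  apply: (@sub_finite_set _ _ [set 0]); last exact: finite_set1.
  apply: tspan_min; first by split=> // u w -> ->; rewrite subr0.
    by move=> u ->; rewrite !raddf0.
  by move: vn; have -> : n = 1%N by apply/eqP; rewrite eqn_leq n1.
pose p := pdiv n; have p_pr : prime p by exact: pdiv_prime.
have nE : n = (p * (n %/ p))%N by rewrite mulnC divnK // pdiv_dvd.
have fY : finite_set (tspan (v *+ p)).
  apply: (IHn (n %/ p)%N).
  - by rewrite ltn_Pdiv ?prime_gt1.
  - by rewrite divn_gt0 ?prime_gt0 // dvdn_leq // pdiv_dvd.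
  - by rewrite -mulrnA -nE.
  - by rewrite act_Mn fv mul0rn.
pose Y := tspan (v *+ p); have sY : zsub Y := tspan_zsub _.
have tY : tstable Y := @tspan_tstable _.
have Yp u : tspan v u -> Y (u *+ p).
  suff : tspan v `<=` [set u | Y (u *+ p)] by exact.
  apply: tspan_min; last by rewrite /=; exact: tspan_id.
    split=> [|a b Ya Yb]; first by rewrite /= mul0rn; exact: (zsub0 sY).
    by rewrite /= mulrnBl; exact: (zsubB sY).
  by move=> a /tY; rewrite !raddfMn.
have pf : ~~ (p %| f`_i)%Z by rewrite fi dvdzE /= gtnNdvd // prime_gt1.
have pP : (p == 0%N) || prime p by rewrite p_pr orbT.
have Yf : Y (act f v) by rewrite fv; exact: (zsub0 sY).
have [d [c [pc _ sp]]] := relation_mod pP sY tY (Yp v (@tspan_id v)) Yf pf.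
pose F (m : {ffun 'I_d -> 'I_p} * V) := \sum_(j < d) iter j t v *+ m.1 j + m.2.
apply: sub_finite_set (finite_image F (finite_setX
  (finite_finset (X := [set: {ffun 'I_d -> 'I_p}])) fY)) => z vz.
have [N [g [gd Yg]]] := sp z vz.
(* A Bezout identity inverts [c ^+ N] modulo [p], and multiples of [p] fall into [Y]. *)
have /coprimezP[[u w] /= uw] : coprimez (c ^+ N) p.
  rewrite coprimezE abszX; apply: coprimeXl.
  by rewrite coprime_sym prime_coprime //; move: pc; rewrite dvdzE.
pose h := u *: g.
have Yh : Y (z - act h v).
  have -> : z - act h v = (z *~ (c ^+ N) - act g v) *~ u + (z *+ p) *~ w.
    rewrite actZ mulrzBl -!mulrzA pmulrn -mulrzA addrAC -mulrzDr.
    by rewrite mulrC (mulrC _ w) uw mulr1z.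
  by apply: (zsubD sY) => //; apply: (zsubMz sY) => //; exact: Yp.
have hd : (size h <= d)%N by rewrite (leq_trans (size_scale_leq _ _)).
have p0 : p%:Z != 0 by rewrite eqz_nat -lt0n prime_gt0.
have hp j : (`|(h`_j %% p)%Z| < p)%N.
  by rewrite -ltz_nat gez0_abs ?modz_ge0 // ltz_pmod // ltz_nat prime_gt0.
(* The coefficients are reduced modulo [p]; the quotients contribute only to the part in [Y]. *)
exists ([ffun j : 'I_d => Ordinal (hp j)], z - \sum_(j < d) iter j t v *~ (h`_j %% p)%Z).
  split=> //=; rewrite -[z](subrK (act h v)) -addrA; apply: (zsubD sY) => //.
  rewrite (act_wide _ hd) -sumrB; apply: (zsub_sum sY) => // j _.
  rewrite -mulrzBr {1}(divz_eq h`_j p) addrK mulrC mulrzA -pmulrn.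
  by apply: (zsubMz sY) => //; exact: (Yp _ (tstable_iter _ (@tspan_tstable v) (@tspan_id v))).
rewrite /F /= addrCA -sumrB big1 ?addr0 // => j _.
by rewrite ffunE /= pmulrn gez0_abs ?modz_ge0 // subrr.
Qed.

End CyclicModules.

(** * Abelian normal subgroups *)

Section AdditiveCopy.
Variables (Q : groupType) (A : set Q).
Hypotheses (sA : subgroup A) (cA : forall x y, A x -> A y -> commute x y).

(* The unused arguments let the module structure be inferred from the type. *)
Definition additive_copy_ of subgroup A &
    (forall x y, A x -> A y -> commute x y) := {x : Q | `[< A x >]}.

HB.instance Definition _ s c := Choice.on (additive_copy_ s c).

Local Notation additive_copy := (additive_copy_ sA cA).

Lemma additive_copyP (u : additive_copy) : A (val u).
Proof. exact/asboolP/(valP u). Qed.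

Definition additive_copy_of x (Ax : A x) : additive_copy := exist _ x (asboolT Ax).

Definition copy_add (u v : additive_copy) : additive_copy :=
  additive_copy_of (subgroupM sA (additive_copyP u) (additive_copyP v)).
Definition copy_opp (u : additive_copy) : additive_copy :=
  additive_copy_of (subgroupV sA (additive_copyP u)).
Definition copy_zero : additive_copy := additive_copy_of (subgroup1 sA).

Lemma copy_addA : associative copy_add.
Proof. by move=> u v w; apply: val_inj; rewrite /= mulgA. Qed.
Lemma copy_addC : commutative copy_add.
Proof. by move=> u v; apply: val_inj; apply: cA; exact: additive_copyP. Qed.
Lemma copy_add0 : left_id copy_zero copy_add.
Proof. by move=> u; apply: val_inj; rewrite /= mul1g. Qed.
Lemma copy_addN : left_inverse copy_zero copy_opp copy_add.
Proof. by move=> u; apply: val_inj; rewrite /= mulVg. Qed.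

HB.instance Definition _ := GRing.isZmodule.Build additive_copy
  copy_addA copy_addC copy_add0 copy_addN.

End AdditiveCopy.

Lemma abelian_zmodType (Q : groupType) (A : set Q) : subgroup A ->
  (forall x y, A x -> A y -> commute x y) ->
  exists (V : zmodType) (i : V -> Q), [/\ injective i, range i = A &
    forall u v, i (u - v)%R = i u / i v].
Proof.
move=> sA cA; exists (additive_copy_ sA cA : zmodType), (@sval _ _); split=> //.
  exact: val_inj.
apply/seteqP; split=> [_ [u _ <-]|x Ax]; first exact: additive_copyP.
by exists (additive_copy_of sA cA Ax).
Qed.

(** Both [h] and [h^-1] are required, since conjugation can map an infinite set properly into
    itself. *)
Lemma subgroup_stab (G : groupType) (P : set G) :
  subgroup [set h | forall y, P y -> P (y ^ h) /\ P (y ^ h^-1)].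
Proof.
split=> [y Py|h k Ph Pk y Py]; first by rewrite invg1 conjg1.
by rewrite invgF !conjgM; split; [apply: (Pk _ (Ph _ Py).1).2|apply: (Ph _ (Pk _ Py).1).2].
Qed.

(** * Conjugation by an element as a module automorphism *)

Section ActionByConjugation.
Import GRing.Theory Num.Theory.
Variables (Q : groupType) (V : zmodType) (i : V -> Q) (x : Q) (t t' : V -> V).
Hypotheses (i_inj : injective i) (iB : forall u v, i (u - v)%R = i u / i v).
Hypotheses (i_t : forall u, i (t u) = i u ^ x).
Hypotheses (i_t' : forall u, i (t' u) = i u ^ x^-1).
Hypothesis (KQ : property_Kbar Q).
Implicit Types (u v z : V) (P : set V) (f g : {poly int}).

Lemma i0 : i 0%R = 1. Proof. by rewrite -(subrr 0%R) iB divgg. Qed.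
Lemma iN u : i (- u)%R = (i u)^-1. Proof. by rewrite -[(- u)%R]sub0r iB i0 div1g. Qed.
Lemma iD u v : i (u + v)%R = i u * i v.
Proof. by rewrite -[v in LHS]opprK iB iN invgK. Qed.
Lemma iMn u n : i (u *+ n)%R = i u ^+ n.
Proof. by elim: n => [|n IHn]; rewrite ?mulr0n ?i0 // mulrS iD IHn expgS. Qed.

Lemma conj_tB : {morph t : u v / (u - v)%R}.
Proof. by move=> u v; apply: i_inj; rewrite i_t !iB !i_t conjMg conjVg. Qed.
Lemma conj_tK : cancel t t'.
Proof. by move=> u; apply: i_inj; rewrite i_t' i_t conjgK. Qed.
Lemma conj_t'K : cancel t' t.
Proof. by move=> u; apply: i_inj; rewrite i_t i_t' conjgKV. Qed.

Let tB := conj_tB.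
Let tK := conj_tK.
Let t'K := conj_t'K.

Lemma conj_t0 : t 0%R = 0%R.
Proof. by rewrite -(subrr 0%R) tB !subrr. Qed.

Lemma i_iter n u : i (iter n t u) = i u ^ (x ^+ n).
Proof. by elim: n => [|n IHn] /=; rewrite ?conjg1 // i_t IHn -conjgM expgSr. Qed.

Lemma iter_t'K n : cancel (iter n t') (iter n t).
Proof. by elim: n => // n IHn u; rewrite iterSr /= t'K. Qed.

Lemma i_iter' n u : i (iter n t' u) = i u ^ (x ^+ n)^-1.
Proof. by rewrite -[u in RHS](iter_t'K n) i_iter conjgK. Qed.

Lemma subgroup_zsub P : zsub P -> subgroup (i @` P).
Proof.
move=> [P0 PB]; split=> [|_ _ [u Pu <-] [v Pv <-]]; first by exists 0%R; rewrite ?i0.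
by exists (u - v)%R; rewrite ?iB //; exact: PB.
Qed.

Lemma act_MXn f u n : act t (f * 'X^n)%R u = iter n t (act t f u).
Proof.
elim: n => [|n IHn] /=; first by rewrite expr0 mulr1.
by rewrite exprSr mulrA (act_tX tB) IHn.
Qed.

(** [P] is the module generated by [u] over the Laurent polynomials in the [m]-th power of [t], with
    denominators cleared by [iter (m * N) t]. Its image contains [i u] and is normalized by
    [x ^+ m]. *)
Lemma orbit_relation_sparse u m :
  let P z := exists N f, (forall k, ~~ (m %| k)%N -> f`_k = 0)%R /\
    iter (m * N) t z = act t f u in
  commutator_subgroup (cyc (i u)) (cyc (x ^+ m)) `<=` i @` P.
Proof.
move=> P; have sP : zsub P.
  split=> [|z1 z2 [N1 [f1 [m1 z1f]]] [N2 [f2 [m2 z2f]]]].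
    exists 0%N, 0%R; split=> [k _|]; first by rewrite coef0.
    by rewrite muln0 /= -(scale0r 0%R) actZ mulr0z.
  exists (N1 + N2)%N, (f1 * 'X^(m * N2) - f2 * 'X^(m * N1))%R; split=> [k mk|].
    rewrite coefB !coefMXn; do 2!case: ltnP => ?; rewrite ?subr0 ?m1 ?m2 ?subr0 //;
      by rewrite dvdn_subl ?dvdn_mulr.
  rewrite actB !act_MXn -z1f -z2f -!iterD (iter_tB tB) -!mulnDr.
  by rewrite [(N2 + N1)%N]addnC.
have Pu : P u.
  exists 0%N, 1%R; split=> [[|k] mk|]; rewrite ?coef1 //; first by rewrite dvdn0 in mk.
  by rewrite muln0 -(expr0 'X) actXn.
have sub_iP := subgroup_zsub sP.
have iP_stab : cyc (x ^+ m) `<=`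
    [set h | forall y, (i @` P) y -> (i @` P) (y ^ h) /\ (i @` P) (y ^ h^-1)].
  apply: cyc_min; first exact: subgroup_stab.
  move=> _ [z [N [f [mf zf]]] <-]; split.
    exists (iter m t z); last by rewrite i_iter.
    exists N, (f * 'X^m)%R; split=> [k mk|]; last by rewrite act_MXn -zf -!iterD addnC.
    by rewrite coefMXn; case: ltnP => // km; apply: mf; rewrite dvdn_subl.
  exists (iter m t' z).
    by exists N.+1, f; split=> //; rewrite mulnS addnC iterD iter_t'K.
  by rewrite i_iter'.
apply: comm_min => // y h Py /iP_stab ih.
have {}Py : (i @` P) y by apply: cyc_min Py => //; exists u.
by rewrite commgEl; apply: subgroupM; [|exact: subgroupV|exact: (ih _ Py).1].
Qed.

(* The relation t ^ (2 ^ j) u = f(t ^ (2 ^ l)) u with j < l is nontrivial modulo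
   every prime. *)
Lemma orbit_relation u : exists f k, (f`_k = 1)%R /\ act t f u = 0%R.
Proof.
have [j [l [jl jlE]]] := finite_pigeonhole
  (f := fun n => commutator_subgroup (cyc (i u)) (cyc (x ^+ (2 ^ n))))
  (KQ (subgroup_cyc (i u))) (fun n => ex_intro2 _ _ _ (subgroup_cyc _) erefl).
have : commutator_subgroup (cyc (i u)) (cyc (x ^+ (2 ^ j))) [~ i u, x ^+ (2 ^ j)].
  by apply: commR; exact: cyc_id.
rewrite jlE => /orbit_relation_sparse[z [N [f [fk zf]]]].
rewrite commgEl -i_iter -iN -iD addrC => /i_inj zu.
(* The exponent [2 ^ l * N + 2 ^ j] is not a multiple of [2 ^ l] because [j < l], so [f] does not
   disturb the coefficient 1 there. *)
exists ('X^(2 ^ l * N + 2 ^ j) - 'X^(2 ^ l * N) - f)%R, (2 ^ l * N + 2 ^ j)%N; split.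
  rewrite !coefB !coefXn eqxx fk.
    by rewrite -[X in _ == X]addn0 eqn_add2l expn_eq0 !subr0.
  by rewrite dvdn_addr ?dvdn_mulr // gtnNdvd ?expn_gt0 // ltn_exp2l.
by rewrite !actB !(actXn tB) -zf zu (iter_tB tB) -iterD subrr.
Qed.

(** Modulo the span of [t u - u], conjugation by [x] is trivial on the span of [u]; a commutator
    with an [n]-th multiple is therefore an [n]-th multiple of a displacement in that submodule. *)
Lemma comm_cyc_sub u n :
  commutator_subgroup (cyc x) (cyc (i u ^+ n)) `<=`
  [set i (s *+ n)%R | s in tspan t t' (t u - u)%R].
Proof.
set w := (t u - u)%R.
have sw : zsub (tspan t t' w) := tspan_zsub _ _ _.
have tw : tstable t t' (tspan t t' w) := @tspan_tstable _ _ _ _.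
have su : zsub (tspan t t' u) := tspan_zsub _ _ _.
have tu : tstable t t' (tspan t t' u) := @tspan_tstable _ _ _ _.
(* [D y] says that conjugation by [y] preserves the span of [u] and displaces its elements by
   elements of the span of [w]. *)
pose D y := forall b, tspan t t' u b -> exists b',
  [/\ tspan t t' u b', i b' = i b ^ y & tspan t t' w (b' - b)%R].
have DM (y z : Q) : D y -> D z -> D (y * z).
  move=> Dy Dz b ub; have [b1 [ub1 ib1 wb1]] := Dy b ub.
  have [b2 [ub2 ib2 wb2]] := Dz b1 ub1; exists b2; split=> //.
    by rewrite ib2 ib1 conjgM.
  by rewrite -[(b2 - b)%R](subrKA b1); exact: (zsubD sw).
have tD b : tspan t t' u b -> tspan t t' w (t b - b)%R.
  suff : tspan t t' u `<=` [set b | tspan t t' w (t b - b)%R] by exact.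
  apply: tspan_min; last exact: tspan_id.
    split=> [|b1 b2 wb1 wb2]; first by rewrite /= conj_t0 subr0; exact: (zsub0 sw).
    rewrite /= tB opprB [(b2 - b1)%R]addrC addrACA [(- _ + b2)%R]addrC.
    by rewrite -(opprB (t b2)); exact: (zsubB sw).
  move=> b1 wb1 /=; have [] := tw _ wb1.
  by rewrite tB (t'B tB tK t'K) tK t'K.
have xD y : cyc x y -> D y.
  have sD : subgroup [set y | D y /\ D y^-1].
    split=> [|y1 y2 [Dy Dy'] [Dz Dz']].
      rewrite /= invg1; suff D1 : D 1 by split.
      by move=> b ub; exists b; rewrite conjg1 subrr; split=> //; exact: (zsub0 sw).
    by rewrite /= invgF; split; exact: DM.
  suff xD : cyc x `<=` [set y | D y /\ D y^-1] by move=> /xD[].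
  apply: cyc_min => //; split=> b ub.
    by exists (t b); rewrite i_t; split=> //; [case: (tu _ ub)|exact: tD].
  exists (t' b); rewrite i_t'; have [_ ut'b] := tu _ ub; split=> //.
  by rewrite -[b in (_ - b)%R]t'K -opprB; apply: (zsubN sw); exact: tD.
apply: comm_min => [|y h /xD Dy].
  split=> [|_ _ [s ws <-] [r wr <-]].
    by exists 0%R; [exact: (zsub0 sw)|rewrite mul0rn i0].
  by exists (s - r)%R; [exact: (zsubB sw)|rewrite mulrnBl iB].
have sC : subgroup [set i (b *+ n)%R | b in tspan t t' u].
  split=> [|_ _ [s ws <-] [r wr <-]].
    by exists 0%R; [exact: (zsub0 su)|rewrite mul0rn i0].
  by exists (s - r)%R; [exact: (zsubB su)|rewrite mulrnBl iB].
have uC : [set i (b *+ n)%R | b in tspan t t' u] (i u ^+ n).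
  by exists u; [exact: tspan_id|rewrite iMn].
move=> /(cyc_min sC uC)[b ub <-]; have [b' [ub' ib' wb']] := Dy b ub.
exists (b - b')%R; first by rewrite -opprB; exact: (zsubN sw).
by rewrite mulrnBl addrC iD iN commgEr conjVg (iMn b) conjXg -ib' -(iMn b').
Qed.

(** Kbar for the cyclic group of [x] and the powers [i u ^+ (p ^ n)] supplies the divisibility
    required by [torsion]; the relation of [u] also annihilates [t u - u] and has a coefficient 1,
    so [finite_tspan] applies. *)
Lemma finite_tspan_displacement u : finite_set (tspan t t' (t u - u)%R).
Proof.
have [f [k [fk fu]]] := orbit_relation u.
have fw : act t f (t u - u)%R = 0%R.
  by rewrite (act_subr tB) (act_t tB) fu conj_t0 subr0.
have f0 : f != 0%R by apply: contra_eq_neq fk => ->; rewrite coef0 eq_sym oner_eq0.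
have [p p_pr|n n_gt0 wn] := torsion tB tK t'K f0 fw.
  have [j [l [jl jlE]]] := finite_pigeonhole
    (f := fun n => commutator_subgroup (cyc x) (cyc (i u ^+ (p ^ n))))
    (KQ (subgroup_cyc x)) (fun n => ex_intro2 _ _ _ (subgroup_cyc _) erefl).
  have : commutator_subgroup (cyc x) (cyc (i u ^+ (p ^ j))) [~ x, i u ^+ (p ^ j)].
    by apply: commR; exact: cyc_id.
  rewrite jlE => /comm_cyc_sub[s ws].
  have sw : zsub (tspan t t' (t u - u)%R) := tspan_zsub _ _ _.
  have -> : [~ x, i u ^+ (p ^ j)] = i (- ((t u - u) *+ p ^ j))%R.
    by rewrite commgEr conjVg conjXg -i_t -!iMn -iN -iD mulrnBl opprB addrC.
  (* The sign comes from the commutator being minus the displacement; [p ^ l] splits as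
     [p ^ (l - j.+1)] times [p ^ j.+1]. *)
  move=> /i_inj sE; exists j, (- s *+ p ^ (l - j.+1))%R; split.
    by apply: (zsubMn sw); exact: (zsubN sw).
  by rewrite -mulrnA -expnD subnK // mulNrn sE opprK.
exact: (finite_tspan tB tK t'K n_gt0 wn fw fk).
Qed.

(** By Kbar there are finitely many subgroups [commutator_subgroup (cyc x) (cyc a)], and each is
    finite by the preceding results. *)
Lemma finite_comm_orbit : finite_set [set [~ x, a] | a in range i].
Proof.
pose F := [set commutator_subgroup (cyc x) (cyc a) | a in range i].
have fF : finite_set F.
  apply: sub_finite_set (KQ (subgroup_cyc x)) => _ [a _ <-].
  by exists (cyc a) => //; exact: subgroup_cyc.
apply: (@sub_finite_set _ _ (\bigcup_(L in F) L)).
  move=> _ [a ia <-]; exists (commutator_subgroup (cyc x) (cyc a)); first by exists a.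
  by apply: commR; exact: cyc_id.
apply: bigcup_finite => // _ [_ [u _ <-] <-].
rewrite -[i u]expg1; apply: sub_finite_set (@comm_cyc_sub u 1) _.
exact/finite_image/finite_tspan_displacement.
Qed.

End ActionByConjugation.

Lemma finite_comm_abelian_normal (Q : groupType) (A : set Q) (x : Q) :
  property_Kbar Q -> normal_in A setT -> (forall a b, A a -> A b -> commute a b) ->
  finite_set [set [~ x, a] | a in A].
Proof.
move=> KQ [sA _ nA] cA; have [V [i [i_inj iA iB]]] := abelian_zmodType sA cA.
have conjA y : exists t : V -> V, forall u, i (t u) = i u ^ y.
  have /choice[t tP] : forall u, exists v, i v = i u ^ y; last by exists t.
  move=> u; suff [v _ vE] : range i (i u ^ y) by exists v.
  rewrite iA; apply: nA => //; rewrite -iA; exact: imageT.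
have [[t i_t] [t' i_t']] := (conjA x, conjA x^-1).
by rewrite -iA; exact: (finite_comm_orbit i_inj iB i_t i_t' KQ).
Qed.

(** * Finitely generated soluble-by-finite groups *)

Section CentreOfFiniteIndex.
Variable G : groupType.
Implicit Types (E N K S : set G) (g c u v x y : G).

(** The set is the preimage of the centre of [E]/[N]. *)
Lemma subgroup_central_mod E N : subgroup E -> normal_in N E ->
  subgroup [set c | E c /\ forall g, E g -> N [~ g, c]].
Proof.
move=> sE [sN _ nN]; split=> [|x y [Ex Nx] [Ey Ny]].
  by split=> [|g _]; [exact: subgroup1|rewrite commg1; exact: subgroup1].
split=> [|g Eg]; first exact: sE.2.
have EyV := subgroupV sE Ey.
have yV : N [~ g, y^-1].
  have -> : [~ g, y^-1] = [~ g, y]^-1 ^ y^-1.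
    by apply: (@mulIg _ ([~ g, y] ^ y^-1)); rewrite -commgMr mulgV commg1 -conjMg mulVg conj1g.
  by apply: nN => //; apply: subgroupV => //; exact: Ny.
by rewrite commgMr; apply: subgroupM => //; apply: nN => //; exact: Nx.
Qed.

Let Z := [set c : G | forall g, setT g -> commute c g].

Lemma conj_central z g : Z z -> z ^ g = z.
Proof. by move=> Zz; apply/conjg_fixP/commgP/Zz. Qed.

Lemma commgV_central u v : Z [~ u, v] -> [~ u, v^-1] = [~ u, v]^-1.
Proof.
move=> Zuv; have := commgMr u v v^-1.
by rewrite mulgV commg1 conj_central // => /esym/mulg1_eq <-; rewrite invgK.
Qed.

(** Where the values are central, commutation with [u] is a homomorphism. *)
Lemma subgroup_commr K u : subgroup K -> K `<=` Z -> subgroup [set v | K [~ u, v]].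
Proof.
move=> sK KZ; split=> [|v w Kv Kw]; first by rewrite /= commg1; exact: subgroup1.
rewrite /= commgMr conj_central; last exact: KZ.
rewrite commgV_central; last exact: KZ.
by apply: subgroupM => //; exact: subgroupV.
Qed.

Lemma subgroup_comml K v : subgroup K -> K `<=` Z -> subgroup [set u | K [~ u, v]].
Proof.
move=> sK KZ; have -> : [set u | K [~ u, v]] = [set u | K [~ v, u]].
  apply/seteqP; split=> u Ku; rewrite /= -invgR; exact: subgroupV.
exact: subgroup_commr.
Qed.

Lemma comm_cyc_central x y : Z [~ x, y] ->
  commutator_subgroup (cyc x) (cyc y) = cyc [~ x, y].
Proof.
move=> Zxy; apply/seteqP; split; last first.
  by apply: cyc_min; [exact: subgroup_comm|apply: commR; exact: cyc_id].
have cZ : cyc [~ x, y] `<=` Z by apply: cyc_min => //; exact: subgroup_cent.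
have sc := subgroup_cyc [~ x, y].
apply: comm_min => // u v xu yv.
have Kuy : cyc [~ x, y] [~ u, y].
  exact: (cyc_min (subgroup_comml y sc cZ) (@cyc_id _ [~ x, y]) xu).
exact: (cyc_min (subgroup_commr u sc cZ) Kuy yv).
Qed.

(** The commutators form a homomorphic image of [K], and Kbar allows it only finitely many cyclic
    subgroups by [comm_cyc_central]. *)
Lemma finite_comm_central x K : property_Kbar G -> subgroup K ->
  (forall c, K c -> Z [~ x, c]) -> finite_set [set [~ x, c] | c in K].
Proof.
move=> KG sK ZK; apply: finite_subgroup_of_cyc.
  split=> [|_ _ [c Kc <-] [d Kd <-]].
    by exists 1; [exact: subgroup1|rewrite commg1].
  exists (c / d); first exact: sK.2.
  rewrite commgMr conj_central ?commgV_central; try exact: ZK.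
  exact/esym/(ZK c Kc).
apply: sub_finite_set (KG _ (subgroup_cyc x)) => _ [_ [c Kc <-] <-].
exists (cyc c); first exact: subgroup_cyc.
by rewrite comm_cyc_central //; exact: ZK.
Qed.

(** The centre is the intersection of the centralizers of finitely many generators [t], so each of
    these is shown to have finite index, by passing from [C] to [C1], where commutators with [t] are
    central, and then to the centralizer of [t]. *)
Lemma fin_index_centre (s : seq G) (A : set G) :
  property_Kbar G -> generated [set` s] = setT ->
  normal_in A setT -> (forall a b, A a -> A b -> commute a b) ->
  fin_index setT [set c | setT c /\ forall g, setT g -> A [~ g, c]] ->
  fin_index setT Z.
Proof.
move=> KG gens nA cA; set C := (C in fin_index _ C) => fC.
have sA : subgroup A by case: nA.
have sC : subgroup C by exact: subgroup_central_mod.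
have sZ : subgroup Z by exact: subgroup_cent.
have gensZ : [set c | forall t, t \in s -> commute t c] `<=` Z.
  move=> c sc g _; suff: generated [set` s] `<=` [set g | commute c g].
    by rewrite gens; apply.
  apply: generated_min => [|t ts]; last exact/commute_sym/sc.
  have := @subgroup_cent _ [set c]; congr subgroup.
  by apply/seteqP; split=> y /= cy; [|move=> _ ->]; apply: commute_sym => //; exact: cy.
have [T [f [ff fZ]]] : fin_index A Z.
  apply: fin_index_sub gensZ _; apply: fin_index_seqI => t _.
  apply: (@fin_index_sub _ _ [set a | A a /\ commute t a]) => [a []//|].
  by apply: fin_index_cent => //; exact: finite_comm_abelian_normal.
apply: fin_index_sub gensZ _; apply: fin_index_seqI => t _.
apply: fin_index_trans fC _.
pose C1 := [set c | C c /\ Z [~ t, c]].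
have sC1 : subgroup C1.
  have sZt := subgroup_commr t sZ (@subset_refl _ Z).
  split=> [|x y [Cx Zx] [Cy Zy]]; split.
  - exact: subgroup1.
  - exact: (subgroup1 sZt).
  - exact: sC.2.
  - exact: sZt.2.
apply: (@fin_index_trans _ _ C1).
  (* Commutators of [t] with [C] lie in [A], where [Z] already has finite index; equal labels make
     two commutators agree modulo [Z]. *)
  exists T, (fun c => f [~ t, c]); split.
    apply: sub_finite_set ff => _ [c [_ Ac] <-].
    by exists [~ t, c] => //; exact: Ac.
  move=> x y Cx Cy fxy; split; first exact: sC.2.
  have Zxy := fZ _ _ (Cx.2 t I) (Cy.2 t I) fxy.
  have := commgMr t (x / y) y; rewrite mulgVK => txy.
  have Zw : Z ([~ t, x / y] ^ y).
    have -> : [~ t, x / y] ^ y = ([~ t, x] / [~ t, y]) ^ [~ t, y].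
      by rewrite [RHS]conjgE mulgVK txy mulKg.
    by rewrite conj_central.
  by rewrite /= -(conjgK y [~ t, x / y]) conj_central.
apply: (@fin_index_sub _ _ [set c | C1 c /\ commute t c]) => [c []//|].
by apply: fin_index_cent => //; apply: finite_comm_central => // c [].
Qed.
End CentreOfFiniteIndex.

(** * Descent along the derived series *)

Section DerivedSeries.
Variables (G : groupType) (E : set G).
Hypothesis sE : subgroup E.
Implicit Types (N S : set G) (x y g : G).

Lemma normal_comm N : normal_in N E -> normal_in (commutator_subgroup N N) E.
Proof.
move=> [sN NE nN]; split; first exact: subgroup_comm.
  by apply: comm_min => // x y /NE Ex /NE Ey; exact: subgroupR.
move=> x g Nx Eg; have sC := subgroup_comm N N.
suff : commutator_subgroup N N `<=` [set x | commutator_subgroup N N (x ^ g)].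
  by move/(_ x Nx).
apply: comm_min => [|y z Ny Nz].
  split=> [|y z Cy Cz]; first by rewrite /= conj1g; exact: subgroup1.
  by rewrite /= conjMg conjVg; exact: sC.2.
by rewrite /= conjRg; apply: commR; exact: nN.
Qed.

Lemma normal_derived S n : normal_in S E -> normal_in (derived_series S n) E.
Proof. by move=> nS; elim: n => //= n; exact: normal_comm. Qed.

Lemma finite_index_fin_index S :
  normal_in S E -> finite_index_in S E -> fin_index E S.
Proof.
move=> [sS SE nS] fS; exists (set G), (fun x => [set x * y | y in S]); split=> // x y Ex Ey xy.
have [s Ss <-] : [set y * z | z in S] x.
  by rewrite -xy; exists 1; [exact: subgroup1|rewrite mulg1].
have -> : y * s / y = s ^ y^-1 by rewrite conjgE invgK mulgA.
by apply: nS => //; exact: subgroupV.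
Qed.

(** In the induction step [fin_index_centre] is applied to the quotient of [E] by the next derived
    term, where the image of the current term is abelian and normal, and the result is pulled back
    to [E]. *)
Lemma derived_central_fin_index (s : seq G) S n : property_Kbar G ->
  E = generated [set` s] -> normal_in S E -> fin_index E S ->
  fin_index E [set c | E c /\ forall g, E g -> derived_series S n [~ g, c]].
Proof.
move=> KG Es nS fS; elim: n => [|n IHn].
  case: (nS) => sS SE nSE; apply: fin_index_sub fS => c Sc; split; first exact: SE.
  move=> g Eg; rewrite commgEr; apply: (subgroupM sS) => //; apply: nSE => //.
  exact: (subgroupV sS).
set A := derived_series S n in IHn; set N := derived_series S n.+1.
have nA : normal_in A E by exact: normal_derived.
have nN : normal_in N E by exact: normal_derived.
have [sA AE AJ] := nA.
have [Q [f [fM fE fN]]] := section_group sE nN.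
have KQ := property_Kbar_image sE fM fE KG.
have /choice[r rP] : forall q : Q, exists x, E x /\ f x = q.
  move=> q; have [x Ex fx] : (f @` E) q by rewrite fE.
  by exists x.
have gensQ : generated [set` [seq f x | x <- s]] = setT.
  apply/seteqP; split=> // q _.
  have [Er <-] := rP q.
  suff : E `<=` E `&` f @^-1` generated [set` [seq f x | x <- s]].
    by move=> /(_ _ Er)[].
  rewrite {1}Es; apply: generated_min.
    by apply: subgroup_preimage => //; exact: subgroup_generated.
  move=> x sx; split; first by rewrite Es; exact: generated_in.
  by apply: generated_in; exact: map_f.
have nfA : normal_in (f @` A) setT.
  split=> [|//|_ q [a Aa <-] _]; first exact: (subgroup_image sE fM).
  have [Er <-] := rP q; exists (a ^ r q); first exact: AJ.
  by rewrite (morph_onJ sE fM) //; exact: AE.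
have cfA a b : (f @` A) a -> (f @` A) b -> commute a b.
  move=> [x Ax <-] [y Ay <-]; have [Ex Ey] := (AE _ Ax, AE _ Ay).
  apply/commgP/eqP; rewrite -(morph_onR sE fM) //.
  by apply/fN; [exact: subgroupR|exact: commR].
have fiQ : fin_index setT
    [set c : Q | setT c /\ forall g : Q, setT g -> (f @` A) [~ g, c]].
  have [T [p [fp pA]]] := IHn; exists T, (p \o r); split.
    by apply: sub_finite_set fp => _ [q _ <-]; exists (r q) => //; case: (rP q).
  move=> q q' _ _ pqq'; split=> // g _.
  have [[Eq fq] [Eq' fq']] := (rP q, rP q'); have [Eg fg] := rP g.
  have [Ec Ac] := pA _ _ Eq Eq' pqq'.
  exists [~ r g, r q / r q']; first exact: Ac.
  rewrite (morph_onR sE fM) // (morph_onM fM) ?(morph_onV sE fM) ?fq ?fq' ?fg //.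
  exact: subgroupV.
have [T [p [fp pZ]]] := fin_index_centre KQ gensQ nfA cfA fiQ.
exists T, (p \o f); split.
  by apply: sub_finite_set fp => _ [x _ <-]; exists (f x).
move=> x y Ex Ey pxy; have EyV := subgroupV sE Ey.
have Exy : E (x / y) by exact: sE.2.
split=> // g Eg; apply/fN; first exact: subgroupR.
rewrite (morph_onR sE fM) // (morph_onM fM) // (morph_onV sE fM) //.
by apply/eqP/commgP/commute_sym; exact: (pZ _ _ I I pxy).
Qed.

Lemma fg_soluble_by_finite_derived (s : seq G) : property_Kbar G ->
  E = generated [set` s] -> soluble_by_finite E ->
  finite_set (commutator_subgroup E E).
Proof.
move=> KG Es [S [nS [n Sn] fS]]; apply: Schur_finite_derived => //.
apply: fin_index_sub (derived_central_fin_index n KG Es nS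
  (finite_index_fin_index nS fS)) => c [Ec Sc]; split=> // g Eg.
by apply/commute_sym/commgP/eqP; have := Sc g Eg; rewrite Sn.
Qed.

End DerivedSeries.

(** * From finitely generated subgroups to the whole group *)

Section Ascent.
Variable G : groupType.
Hypothesis KG : property_Kbar G.
Hypothesis fgG : forall s : seq G,
  finite_set (commutator_subgroup (generated [set` s]) (generated [set` s])).
Implicit Types (X : set G) (s : seq G) (x y g : G).

Lemma finite_comm_fg s : finite_set (commutator_subgroup (generated [set` s]) setT).
Proof.
set X := generated _; have sX : subgroup X by exact: subgroup_generated.
pose F := [set commutator_subgroup X (cyc g) | g in setT].
have fF : finite_set F.
  apply: sub_finite_set (KG sX) => _ [g _ <-].
  by exists (cyc g) => //; exact: subgroup_cyc.
have [B [/finite_seqP[b ->] _ Bg]] := finite_imageP fF.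
(* Every value of the commutator subgroup of [X] with a cyclic group is attained at an element of
   [b], hence inside the derived subgroup of [E]. *)
pose E := generated [set` s ++ b].
have sb : [set` s ++ b] `<=` E by move=> x; exact: generated_in.
apply: sub_finite_set (fgG (s ++ b)).
apply: comm_min; first exact: subgroup_comm.
move=> x g Xx _; have [h bh hE] := Bg g I.
have : commutator_subgroup X (cyc g) [~ x, g] by apply: commR => //; exact: cyc_id.
rewrite -hE; apply: comm_sub.
  by apply: generated_sub => y; rewrite /= mem_cat => ->.
apply: cyc_min; first exact: subgroup_generated.
by apply: sb; rewrite /= mem_cat; move: bh => /= ->; rewrite orbT.
Qed.

Lemma finite_comm_elt x : finite_set [set [~ x, g] | g in setT].
Proof.
apply: sub_finite_set (finite_comm_fg [:: x]) => _ [g _ <-].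
by apply: commR => //; apply: generated_in; rewrite /= mem_head.
Qed.

(** Finitely many commutators involve only finitely many chosen entries, and these generate a
    subgroup whose derived subgroup is all of that of [G]. *)
Lemma finite_derived_of_comm :
  finite_set [set [~ x, y] | x in [set: G] & y in [set: G]] ->
  finite_set (commutator_subgroup [set: G] [set: G]).
Proof.
move=> fC; pose c (p : G * G) := [~ p.1, p.2].
have [|B [/finite_seqP[b ->] _ Bc]] := @finite_imageP _ _ c setT.
  by apply: sub_finite_set fC => _ [[x y] _ <-]; exists x => //; exists y.
pose s := [seq p.1 | p <- b] ++ [seq p.2 | p <- b].
apply: sub_finite_set (fgG s); apply: comm_min; first exact: subgroup_comm.
move=> x y _ _; have [[x' y'] bxy] := Bc (x, y) I; rewrite /c /= => <-.
apply: commR; apply: generated_in; rewrite /s /= mem_cat.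
  by rewrite (map_f fst (bxy : (x', y') \in b)).
by rewrite (map_f snd (bxy : (x', y') \in b)) orbT.
Qed.

Lemma finite_comm_cyc x y : finite_set (commutator_subgroup (cyc x) (cyc y)).
Proof.
apply: sub_finite_set (fgG [:: x; y]); apply: comm_sub; apply: generated_sub => _ ->.
  by rewrite /= mem_head.
by rewrite /= !inE eqxx orbT.
Qed.

(** Elements of the generated subgroup are products [c * u] with [u] in [cyc x] and [c] commuting
    with [x] and [y]; the factor [c] has no effect on commutators with [cyc y]. *)
Lemma comm_cyc_centralized X x y : X `<=` [set g | commute g x /\ commute g y] ->
  commutator_subgroup (generated (x |` X)) (cyc y) `<=`
  commutator_subgroup (cyc x) (cyc y).
Proof.
move=> Xc; pose K := [set g | exists c u,
  [/\ g = c * u, cyc x u, commute c x & commute c y]].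
have cyc_commute c z u : commute c z -> cyc z u -> commute c u.
  move=> cz zu; apply/commute_sym.
  have := @cyc_min _ [set v | forall d, [set c] d -> commute v d] z.
  by apply=> //; [exact: subgroup_cent | move=> _ ->; exact/commute_sym].
have sK : subgroup K.
  split=> [|_ _ [c [u [-> xu cx cy]]] [d [v [-> xv dx dy]]]].
    exists 1, 1; rewrite mulg1; split=> //; try exact/commute_sym/commute1.
    by apply: subgroup1; exact: subgroup_cyc.
  exists (c / d), (u / v); have scx := subgroup_cyc x.
  split; first 1 last.
  - exact: scx.2.
  - by apply/commute_sym/commuteM; [|apply: commuteV]; exact/commute_sym.
  - by apply/commute_sym/commuteM; [|apply: commuteV]; exact/commute_sym.
  have dvu : commute d^-1 (u / v).
    apply/commute_sym/commuteV/commute_sym.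
    by apply: cyc_commute dx _; exact: scx.2.
  by rewrite invgM -!mulgA (dvu : _ = _) -mulgA.
have XK : generated (x |` X) `<=` K.
  apply: generated_min => // g [->|/Xc[gx gy]].
    exists 1, x; rewrite mul1g; split=> //; try exact/commute_sym/commute1.
    exact: cyc_id.
  by exists g, 1; rewrite mulg1; split=> //; by apply: subgroup1; exact: subgroup_cyc.
apply: comm_min => [|g h /XK[c [u [-> xu _ cy]]] yh]; first exact: subgroup_comm.
have /commgP/eqP ch : commute c h by exact: cyc_commute cy yh.
by rewrite commgMl ch conj1g mul1g; exact: commR.
Qed.

(* Otherwise there are pairs (x_n, y_n) such that x_n and y_n commute with all
   x_m and y_m for m < n, and [~ x_n, y_n] lies in no [<x_m>, <y_m>].  For the
   subgroup X generated by the x_n the subgroups [X, <y_n>] = [<x_n>, <y_n>] are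
   pairwise distinct. *)
Lemma bounded_comm_centralizer : exists s D, finite_set D /\
  forall x y, (forall z, z \in s -> commute x z /\ commute y z) -> D [~ x, y].
Proof.
apply: contrapT => nosD.
have /choice[nx nxP] : forall l : seq (G * G), exists p : G * G,
    forall q, q \in l -> [/\ commute p.1 q.1, commute p.1 q.2, commute p.2 q.1,
      commute p.2 q.2 & ~ commutator_subgroup (cyc q.1) (cyc q.2) [~ p.1, p.2]].
  move=> l; apply: contrapT => nop; apply: nosD.
  pose D := \bigcup_(q in [set` l]) commutator_subgroup (cyc q.1) (cyc q.2).
  exists ([seq q.1 | q <- l] ++ [seq q.2 | q <- l]), D; split.
    apply: bigcup_finite => [|q _]; first exact: finite_seq.
    exact: finite_comm_cyc.
  move=> x y xyl; apply: contrapT => nD; apply: nop; exists (x, y) => q ql.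
  have [x1 y1] : commute x q.1 /\ commute y q.1.
    by apply: xyl; rewrite mem_cat map_f.
  have [x2 y2] : commute x q.2 /\ commute y q.2.
    by apply: xyl; rewrite mem_cat map_f ?orbT.
  by split=> //= Dq; apply: nD; exists q.
(* [st n] lists the first [n] pairs, latest first, and [p n] is the next pair chosen against
   them. *)
pose st n := iter n (fun l => nx l :: l) [::]; pose p n := nx (st n).
have p_st m n : (m < n)%N -> p m \in st n.
  by elim: n => // n IHn; rewrite ltnS leq_eqVlt /= inE => /predU1P[->|/IHn->]; rewrite ?eqxx ?orbT.
have pP m n : m != n -> commute (p m).1 (p n).1 /\ commute (p m).1 (p n).2.
  rewrite neq_ltn => /orP[] /p_st /nxP[? ? ? ? _]; split=> //; exact/commute_sym.
pose X := generated (range (fun n => (p n).1)).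
have sX : subgroup X by exact: subgroup_generated.
have [m [n [mn eqX]]] := finite_pigeonhole
  (f := fun n => commutator_subgroup X (cyc (p n).2))
  (KG sX) (fun n => ex_intro2 _ _ _ (subgroup_cyc _) erefl).
have : commutator_subgroup X (cyc (p n).2) [~ (p n).1, (p n).2].
  by apply: commR; [apply: generated_in; exists n|exact: cyc_id].
have [_ _ _ _] := nxP _ _ (p_st m n mn); rewrite -eqX => nC XC; apply: nC.
pose Y := [set (p k).1 | k in [set k | k != m]].
have YC : Y `<=` [set g | commute g (p m).1 /\ commute g (p m).2].
  by move=> _ [k km <-]; exact: pP.
apply: (comm_cyc_centralized YC); apply: comm_sub XC => //.
apply: generated_sub => _ [k _ <-].
by have [->|km] := eqVneq k m; [left|right; exists k].
Qed.

(** The centralizer of [s] has finite index. Splitting both entries of a commutator over coset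
    representatives leaves one commutator in [D] and others having a representative as an entry. *)
Lemma finite_derived_ascent : finite_set (commutator_subgroup [set: G] [set: G]).
Proof.
have [s [D [fD sD]]] := bounded_comm_centralizer.
have [T [f [ff fM]]] : fin_index [set: G]
    [set x | forall z, z \in s -> [set h | setT h /\ commute z h] x].
  apply: fin_index_seqI => z _; apply: fin_index_cent => //.
  exact: finite_comm_elt.
have [B [fB _ Bf]] := finite_imageP ff.
pose P := \bigcup_(b in B) [set [~ b, g] | g in [set: G]].
have fP : finite_set P by apply: bigcup_finite => // b _; exact: finite_comm_elt.
(* [F] reassembles [[~ g, h]] from the expansion with [g = (g / b) * b] and [h = (h / c) * c]. *)
pose F (q : G * G * (G * G * G)) :=
  (q.2.1.1^-1 * q.2.1.2 ^ q.1.2) ^ q.1.1 * q.2.2.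
apply: finite_derived_of_comm.
apply: sub_finite_set (finite_image F (finite_setX (finite_setX fB fB)
  (finite_setX (finite_setX fP fD) fP))) => _ [g _ [h _ <-]].
have [b Bb /esym/(fM _ _ I I) gb] := Bf g I.
have [c Bc /esym/(fM _ _ I I) hc] := Bf h I.
exists ((b, c), ([~ c, g / b], [~ g / b, h / c], [~ b, h])).
  do 4?split=> //=.
  - by exists c => //; exists (g / b).
  - by apply: sD => z zs; split; apply: commute_sym; [case: (gb z zs)|case: (hc z zs)].
  - by exists b => //; exists h.
by rewrite /F /= invgR -commgMr mulgVK -commgMl mulgVK.
Qed.

End Ascent.

(** * Finite-by-abelian groups *)

Section FiniteByAbelian.
Variable G : groupType.
Hypothesis fG : finite_by_abelian G.
Let G' := commutator_subgroup [set: G] [set: G].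

Lemma derivedJ z g : G' z -> G' (z ^ g).
Proof.
move=> Gz; rewrite -[z ^ g](mulVKg z) -commgEl.
by apply: (subgroupM (subgroup_comm _ _)) => //; exact: commR.
Qed.

Lemma finite_by_abelian_Kbar : property_Kbar G.
Proof.
move=> X sX; apply: sub_finite_set (finite_subsets fG) => _ [H sH <-].
exact: comm_sub.
Qed.

(** The centralizer [N] of the finite [G'] in [H] has finite index, and its derived subgroup lies in
    [G'], which [N] centralizes, so the second derived term is trivial. *)
Lemma finite_by_abelian_soluble_by_finite (H : set G) :
  subgroup H -> soluble_by_finite H.
Proof.
move=> sH; pose N := H `&` [set x | forall z, G' z -> commute x z].
have sC : subgroup [set x | forall z, G' z -> commute x z] by exact: subgroup_cent.
have sN : subgroup N.
  split=> [|x y [Hx Cx] [Hy Cy]]; first by split; exact: subgroup1.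
  by split; [exact: sH.2|exact: sC.2].
have conjN x y : N x -> H y -> N (x ^ y).
  move=> [Hx Cx] Hy; split=> [|z Gz]; first exact: subgroupJ.
  by rewrite /commute -[z](conjgKV y) -!conjMg (Cx _ (derivedJ y^-1 Gz)).
exists N; split.
- by split=> // x [].
- exists 2; apply/seteqP; split; last first.
    by move=> _ ->; apply: subgroup1; exact: subgroup_comm.
  apply: comm_min => [|x y Nx Ny]; first exact: subgroup_triv.
  have {Nx}[_ Cx] : N x.
    by move: x Nx; apply: comm_min => // x y' Nx Ny'; exact: subgroupR.
  apply/eqP/commgP/Cx; apply: comm_sub Ny => //.
have [l Gl] := (finite_seqP _).1 fG.
apply: (finite_image_factor (f := fun x => [seq z ^ x | z <- l])).
  apply: finite_image_map => z.
  (* All conjugates of [z] lie in the finite coset of [G'] containing [z]. *)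
  apply: sub_finite_set (finite_image (fun c => z * c) fG) => _ [x _ <-].
  by exists [~ z, x]; [exact: commR|rewrite commgEl mulVKg].
move=> x y Hx Hy xy.
have Nxy : N (x^-1 * y).
  split=> [|z Gz]; first by apply: subgroupM => //; exact: subgroupV.
  apply/commute_sym/commgP; rewrite -conjg_fix conjgM.
  have : z ^ x^-1 \in l by have := derivedJ x^-1 Gz; rewrite /G' Gl.
  by move=> /((eq_in_map _ _ _).2 xy) <-; rewrite conjgKV.
apply/seteqP; split=> _ [n Nn <-].
  exists ((x^-1 * y)^-1 * n); last by rewrite invgM invgK !mulgA mulgV mul1g.
  by apply: subgroupM => //; exact: subgroupV.
by exists (x^-1 * y * n); [exact: subgroupM|rewrite !mulgA mulgV mul1g].
Qed.

End FiniteByAbelian.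

Theorem theoremA (G : groupType) :
  finite_by_abelian G <-> locally_soluble_by_finite G /\ property_Kbar G.
Proof.
split=> [fG|[lG KG]].
  split; last exact: finite_by_abelian_Kbar.
  by move=> H sH _; exact: finite_by_abelian_soluble_by_finite.
apply: finite_derived_ascent => // s; apply: fg_soluble_by_finite_derived => //.
- exact: subgroup_generated.
- apply: lG; first exact: subgroup_generated.
  by exists [set` s]; split=> //; exact: finite_seq.
Qed.
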